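(* Let $E$ be a Dedekind complete vector lattice. Then there exists an essentially unique Dedekind complete distributive valuated lattice star $S$ that contains $E$ as a lattice substar such that (i) $T := \{s \vee x : s \in S,\ x \in E\}$ is lattice semistar isomorphic to the sup-completion $E^s$ of $E$, and (ii) $s = \sup\{\inf\{x-y : y \in [s^-]^{\leq}_+\} : x \in [s^+]^{\leq}_+\}$ for all $s \in S$. That is, such an $S$ exists, and any two such lattice stars are lattice star isomorphic.
   Context: Notation: $\mathbb{R}^+=[0,\infty)$; $E^+$ is the positive cone of $E$. Stars. A star is a set $S$ with a scalar multiplication $\mathbb{R}\times S\to S$ such that $\lambda(\mu x)=(\lambda\mu)x$, $1x=x$, and there is an element $0\in S$ with $0x=0$ for all $x\in S$. Write $-x:=(-1)x$. An ordered star is a star with a partial order such that $x\le y$ implies $\lambda x\le\lambda y$ for $\lambda\in\mathbb{R}^+$ and $-x\ge -y$. A lattice star is an ordered star in which $x\vee y=\sup\{x,y\}$ (equivalently $x\wedge y=\inf\{x,y\}$) exists for all $x,y$. It is distributive if $x\wedge(y\vee z)=(x\wedge y)\vee(x\wedge z)$ for all $x,y,z$. In a lattice star put $x^+:=x\vee 0$, $x^-:=-(x\wedge 0)$, $|x|:=x\vee(-x)$; it is valuated if $|x|\ge 0$ for all $x$. It is Dedekind complete if every nonempty subset that is bounded above has a supremum (equivalently, every nonempty subset that is bounded below has an infimum). A lattice substar of $S$ is a subset closed under all scalar multiplications, $\vee$ and $\wedge$; ''$S$ contains $E$ as a lattice substar'' means $E\subseteq S$ is such a subset and the scalar multiplication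 and lattice structure of $E$ are those inherited from $S$. A lattice star homomorphism is a map $\phi$ with $\phi(\lambda x)=\lambda\phi(x)$ for $\lambda\in\mathbb{R}$ and $\phi(x\vee y)=\phi(x)\vee\phi(y)$; a lattice star isomorphism is a bijective one. Semistars. A semistar is defined like a star but with a scalar multiplication $\mathbb{R}^+\times S\to S$ only; ordered semistars ($x\le y\Rightarrow\lambda x\le\lambda y$ for $\lambda\in\mathbb{R}^+$), lattice semistars, and lattice semistar isomorphisms (bijections preserving nonnegative scalar multiplication and the lattice operations) are defined analogously. $T$ carries the structure inherited from $S$. For $0\le u\in S$ let $[u]^{\leq}_+:=\{x\in E^+ : x\le u\}$. In (ii), $x-y$ is computed in $E$, and suprema and infima are taken in $S$. Sup-completion. A cone is a commutative monoid $C$ (neutral element $0$) with a scalar multiplication $\mathbb{R}^+\times C\to C$ satisfying $\lambda(x+y)=\lambda x+\lambda y$, $(\lambda+\mu)x=\lambda x+\mu x$, $\lambda(\mu x)=(\lambda\mu)x$, $1x=x$, $0x=0$. It is an ordered cone if partially ordered with $x\le y\Rightarrow x+z\le y+z$ and $\lambda x\le\lambda y$ ($\lambda\in\mathbb{R}^+$), a lattice cone if moreover the order is a lattice, and Dedekind complete if nonempty subsets bounded above (below) have suprema (infima). $C_0$ is the set of additively invertible elements. The sup-completion $E^s$ of $E$ is the essentially unique lattice cone $C$ such that: $C$ is Dedekind complete; $E=C_0$ with coinciding algebraic and order structures; $y=\sup\{x\in E: x\le y\}$ for every $y\in C$; $z+(x\wedge y)=(z+x)\wedge(z+y)$ for $x\in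 E$, $y,z\in C$; if $x\in E$, $y\in C$, $y\le x$, then $y\in E$; $C$ has a largest element; and if $A,B\subseteq C$ are nonempty with $\sup A=\sup B$ then $\sup(A\wedge x)=\sup(B\wedge x)$ for all $x\in E$. *)

(* Defs.v *)
From HB Require Import structures.
From mathcomp Require Import all_boot all_order all_algebra.
From mathcomp Require Import boolp classical_sets functions reals.

Set Implicit Arguments.
Unset Strict Implicit.
Unset Printing Implicit Defensive.

Import Order.TTheory GRing.Theory Num.Theory.

Local Open Scope classical_set_scope.
Local Open Scope ring_scope.

(* In a semistar only the nonnegative scalars act: [sscale] is a total function
   on [R] for convenience, but its values at negative scalars are
   unconstrained, and no semistar notion below refers to them. *)
HB.mixin Record isSemistar (R : realType) (S : Type) := {
  sscale : R -> S -> S ;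
  szero : S ;
  sscaleA_nneg : forall (a b : R) (x : S), 0 <= a -> 0 <= b ->
    sscale a (sscale b x) = sscale (a * b) x ;
  sscale1 : forall x : S, sscale 1 x = x ;
  sscale0 : forall x : S, sscale 0 x = szero
}.
#[short(type="semistarType")]
HB.structure Definition Semistar (R : realType) :=
  { S of isSemistar R S & Choice S }.

Reserved Notation "a *! x" (at level 40, left associativity).
Notation "a *! x" := (sscale a x) : ring_scope.

HB.mixin Record Semistar_isStar (R : realType) S of Semistar R S := {
  sscaleA : forall (a b : R) (x : S), a *! (b *! x) = (a * b) *! x
}.
#[short(type="starType")]
HB.structure Definition Star (R : realType) :=
  { S of Semistar_isStar R S & Semistar R S }.

HB.mixin Record Semistar_isOrdered (R : realType) S
    of Semistar R S & Order.POrder ring_display S := {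
  ler_sscale : forall (a : R) (x y : S), 0 <= a -> x <= y -> a *! x <= a *! y
}.
#[short(type="orderedSemistarType")]
HB.structure Definition OrderedSemistar (R : realType) :=
  { S of Semistar_isOrdered R S & Semistar R S & Order.POrder ring_display S }.

HB.mixin Record Star_isOrdered (R : realType) S
    of OrderedSemistar R S & Star R S := {
  ler_sscaleN1 : forall x y : S,
    x <= y -> ((-1 : R) *! y) <= ((-1 : R) *! x)
}.
#[short(type="orderedStarType")]
HB.structure Definition OrderedStar (R : realType) :=
  { S of Star_isOrdered R S & OrderedSemistar R S & Star R S }.

#[short(type="latticeSemistarType")]
HB.structure Definition LatticeSemistar (R : realType) :=
  { S of OrderedSemistar R S & Order.Lattice ring_display S }.

#[short(type="latticeStarType")]
HB.structure Definition LatticeStar (R : realType) :=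
  { S of OrderedStar R S & Order.Lattice ring_display S }.

(* The neutral element of the addition of a cone is [szero], the value of all
   products [0 *! x]. *)
HB.mixin Record Semistar_isCone (R : realType) C of Semistar R C := {
  cadd : C -> C -> C ;
  caddA : associative cadd ;
  caddC : commutative cadd ;
  cadd0 : left_id szero cadd ;
  sscaleDr : forall (a : R) (x y : C), 0 <= a ->
    a *! (cadd x y) = cadd (a *! x) (a *! y) ;
  sscaleDl : forall (a b : R) (x : C), 0 <= a -> 0 <= b ->
    (a + b) *! x = cadd (a *! x) (b *! x)
}.
#[short(type="coneType")]
HB.structure Definition Cone (R : realType) :=
  { C of Semistar_isCone R C & Semistar R C }.

Reserved Notation "x +! y" (at level 50, left associativity).
Notation "x +! y" := (cadd x y) : ring_scope.

HB.mixin Record Cone_isOrdered (R : realType) C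
    of Cone R C & OrderedSemistar R C := {
  ler_cadd2r : forall z x y : C, x <= y -> x +! z <= y +! z
}.
#[short(type="orderedConeType")]
HB.structure Definition OrderedCone (R : realType) :=
  { C of Cone_isOrdered R C & Cone R C & OrderedSemistar R C }.

#[short(type="latticeConeType")]
HB.structure Definition LatticeCone (R : realType) :=
  { C of OrderedCone R C & Order.Lattice ring_display C }.

(* A record on top of [lmodType] rather than an HB structure: the joins of
   [GRing.Zmodule] and [Order.Lattice] in the library are [Num.RealDomain] and
   its heirs, so HB rejects a new join of these two structures. *)
Record vectorLatticeType (R : realType) := VectorLattice {
  vl_lmod : lmodType R ;
  vl_le : rel vl_lmod ;
  vl_meet : vl_lmod -> vl_lmod -> vl_lmod ;
  vl_join : vl_lmod -> vl_lmod -> vl_lmod ;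
  vl_le_refl : reflexive vl_le ;
  vl_le_anti : antisymmetric vl_le ;
  vl_le_trans : transitive vl_le ;
  vl_lexI : forall x y z, vl_le x (vl_meet y z) = vl_le x y && vl_le x z ;
  vl_leUx : forall x y z, vl_le (vl_join x y) z = vl_le x z && vl_le y z ;
  vl_leD2r : forall z x y, vl_le x y -> vl_le (x + z) (y + z) ;
  vl_le_scale : forall (a : R) x y, 0 <= a -> vl_le x y ->
    vl_le (a *: x) (a *: y)
}.

Definition vl_sort (R : realType) (E : vectorLatticeType R) : Type :=
  vl_lmod E.
Coercion vl_sort : vectorLatticeType >-> Sortclass.

HB.instance Definition _ (R : realType) (E : vectorLatticeType R) :=
  GRing.Lmodule.copy (vl_sort E) (vl_lmod E).
HB.instance Definition _ (R : realType) (E : vectorLatticeType R) :=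
  Order.Le_isPOrder.Build ring_display (vl_sort E)
    (@vl_le_refl R E) (@vl_le_anti R E) (@vl_le_trans R E).
HB.instance Definition _ (R : realType) (E : vectorLatticeType R) :=
  Order.POrder_MeetJoin_isLattice.Build ring_display (vl_sort E)
    (@vl_lexI R E) (@vl_leUx R E).

Lemma vl_lerD2r (R : realType) (E : vectorLatticeType R) (z x y : E) :
  x <= y -> x + z <= y + z.
Proof. exact: vl_leD2r. Qed.

Lemma vl_ler_scale (R : realType) (E : vectorLatticeType R) (a : R) (x y : E) :
  0 <= a -> x <= y -> a *: x <= a *: y.
Proof. exact: vl_le_scale. Qed.

Definition dedekind_complete d (T : porderType d) : Prop :=
  forall A : set T, A !=set0 -> has_ubound A -> supremums A !=set0.

Lemma dedekind_complete_inf d (T : porderType d) : dedekind_complete T ->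
  forall A : set T, A !=set0 -> has_lbound A -> infimums A !=set0.
Proof.
move=> dT A [a Aa] lA.
have [|m [um lm]] := dT (lbound A) lA; first by exists a => x; apply.
by exists m; split => [x Ax|//]; apply: lm => y; apply.
Qed.

Definition is_distributive (R : realType) (S : latticeStarType R) : Prop :=
  right_distributive (@Order.meet _ S) (@Order.join _ S).

Definition sopp (R : realType) (S : starType R) (x : S) : S := (-1 : R) *! x.

Definition spos (R : realType) (S : latticeStarType R) (x : S) : S :=
  (x `|` szero)%O.

Definition sneg (R : realType) (S : latticeStarType R) (x : S) : S :=
  sopp (x `&` szero)%O.

Definition sabs (R : realType) (S : latticeStarType R) (x : S) : S :=
  (x `|` sopp x)%O.

Definition is_valuated (R : realType) (S : latticeStarType R) : Prop :=
  forall x : S, szero <= sabs x.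

(* "S contains E as a lattice substar", the inclusion being [i]: the range of
   such an [i] is closed under the operations of S, and the structure it
   inherits is that of E. *)
Definition lattice_substar_embedding (R : realType) (E : vectorLatticeType R)
    (S : latticeStarType R) (i : E -> S) : Prop :=
  [/\ injective i,
      forall (a : R) (x : E), i (a *: x) = a *! i x,
      forall x y : E, i (x `|` y)%O = (i x `|` i y)%O
    & forall x y : E, i (x `&` y)%O = (i x `&` i y)%O].

Definition lattice_star_hom (R : realType) (S1 S2 : latticeStarType R)
    (phi : S1 -> S2) : Prop :=
  (forall (a : R) (x : S1), phi (a *! x) = a *! phi x) /\
  (forall x y : S1, phi (x `|` y)%O = (phi x `|` phi y)%O).

Definition lattice_star_isomorphic (R : realType) (S1 S2 : latticeStarType R)
    : Prop :=
  exists phi : S1 -> S2, bijective phi /\ lattice_star_hom phi.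

(* Lattice semistar isomorphism onto [C] of a subset [T] of [S] that is closed
   under nonnegative scalars, joins and meets, with the inherited structure. *)
Definition lattice_semistar_iso_on (R : realType)
    (S C : latticeSemistarType R) (T : set S) (phi : S -> C) : Prop :=
  [/\ set_bij T [set: C] phi,
      forall (a : R) (x : S), 0 <= a -> T x -> phi (a *! x) = a *! phi x,
      forall x y : S, T x -> T y -> phi (x `|` y)%O = (phi x `|` phi y)%O
    & forall x y : S, T x -> T y -> phi (x `&` y)%O = (phi x `&` phi y)%O].

(* [C] is a sup-completion of [E], the inclusion of E in C being [j]. By
   [sc_top] and [sc_dedekind] every nonempty subset of C has a supremum, so an
   equality of the (then singleton) sets of suprema says sup A = sup B. *)
Record is_sup_completion (R : realType) (E : vectorLatticeType R)
    (C : latticeConeType R) (j : E -> C) : Prop := {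
  sc_dedekind : dedekind_complete C ;
  sc_range : range j = [set y : C | exists z : C, y +! z = szero] ;
  sc_add : forall x y : E, j (x + y) = j x +! j y ;
  sc_scale : forall (a : R) (x : E), 0 <= a -> j (a *: x) = a *! j x ;
  sc_le : forall x y : E, (j x <= j y) = (x <= y) ;
  sc_dense : forall y : C, supremums [set z | range j z /\ z <= y] y ;
  sc_addI : forall (x : E) (y z : C),
    z +! (j x `&` y)%O = ((z +! j x) `&` (z +! y))%O ;
  sc_ideal : forall (x : E) (y : C), y <= j x -> range j y ;
  sc_top : exists t : C, forall y : C, y <= t ;
  sc_meet : forall A B : set C, A !=set0 -> B !=set0 ->
    supremums A = supremums B ->
    forall x : E, supremums [set (a `&` j x)%O | a in A] =
                  supremums [set (b `&` j x)%O | b in B]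
}.

(* T = {s \/ x : s in S, x in E}; when S is distributive it is the set of all
   elements of S above some element of E, hence it is closed under nonnegative
   scalars, joins and meets. *)
Definition join_set (R : realType) (E : vectorLatticeType R)
    (S : latticeStarType R) (i : E -> S) : set S :=
  [set t | exists (s : S) (x : E), t = (s `|` i x)%O].

Definition join_set_iso_sup_completion (R : realType)
    (E : vectorLatticeType R) (S : latticeStarType R) (i : E -> S) : Prop :=
  exists (C : latticeConeType R) (j : E -> C) (phi : S -> C),
    is_sup_completion j /\ lattice_semistar_iso_on (join_set i) phi.

Definition pos_below (R : realType) (E : vectorLatticeType R)
    (S : latticeStarType R) (i : E -> S) (u : S) : set E :=
  [set x | 0 <= x /\ i x <= u].

(* [f x] is the inner infimum; its existence, and that of the outer supremum,
   are part of the condition. *)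
Definition sup_inf_representation (R : realType) (E : vectorLatticeType R)
    (S : latticeStarType R) (i : E -> S) : Prop :=
  forall s : S, exists f : E -> S,
    (forall x, pos_below i (spos s) x ->
       infimums [set i (x - y) | y in pos_below i (sneg s)] (f x)) /\
    supremums [set f x | x in pos_below i (spos s)] s.

Record is_star_completion (R : realType) (E : vectorLatticeType R)
    (S : latticeStarType R) (i : E -> S) : Prop := {
  star_dedekind : dedekind_complete S ;
  star_distributive : is_distributive S ;
  star_valuated : is_valuated S ;
  star_substar : lattice_substar_embedding i ;
  star_join_set : join_set_iso_sup_completion i ;
  star_sup_inf : sup_inf_representation i
}.

(* Main.v *)
(* The elements of the sup-completion of E are realized as cuts: nonempty lower
   sets of E closed under the suprema that exist in E.  The star S is realized
   as the set of pairs (A, B) of disjoint nonnegative cuts, to be thought of as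
   positive and negative parts, ordered by A <= A' and B' <= B.

   Uniqueness: by (ii) an element s of any such S is determined by s^+ and s^-,
   and a nonnegative element u by the cut {x | i x <= u}, so that S embeds into
   the star of pairs.  That {x | i x <= u} is a cut and that every pair is
   attained both come from (i): the distributivity of the sup-completion over
   infinite suprema passes to T, although the isomorphism in (i) is not assumed
   to be compatible with the two copies of E. *)
From HB Require Import structures.
Require Import Defs.
From mathcomp Require Import all_boot all_order all_algebra reals.
From mathcomp Require Import boolp classical_sets functions.

Set Implicit Arguments.
Unset Strict Implicit.
Unset Printing Implicit Defensive.

Import Order.TTheory GRing.Theory Num.Theory.

Local Open Scope classical_set_scope.
Local Open Scope ring_scope.

(** The obstacle to uniqueness is that [S] has no addition and that the isomorphism [phi] of [upper]
    with a sup-completion says nothing about [i]. Only statements made of order, lattice operations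
    and nonnegative scalars can be carried back through [phi]. The lemma [sc_gap] is shaped by this:
    its proof subtracts freely inside [E], but its conclusion replaces the difference of [c] and [t]
    by a ratio [k < 1], namely that on the part of [c] marked by some nonzero [w] the element [t]
    stays below [k *! c]. A ratio makes sense in a star, and when [c] and [w] are brought back to
    [E] it contradicts a supremum there. In the model, condition (i) comes from sending a cut to the
    pair of its positive and negative parts. Every pair above an element of [E] is reached because
    its negative part is bounded, hence principal by Dedekind completeness, and a principal cut can
    be subtracted from the positive part. *)

Section VectorLattice.
Context {R : realType} {E : vectorLatticeType R}.
Implicit Types (x y z : E) (a b : R).

(** * Arithmetic of vector lattices *)

Lemma vl_lerD2rE z x y : (x + z <= y + z) = (x <= y).
Proof.
apply/idP/idP => [h|]; last exact: vl_lerD2r.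
by have := vl_lerD2r (- z) h; rewrite !addrK.
Qed.

Lemma vl_lerBDr x y z : (x - y <= z) = (x <= z + y).
Proof. by rewrite -(vl_lerD2rE y (x - y)) subrK. Qed.

Lemma vl_lerBrD x y z : (x <= y - z) = (x + z <= y).
Proof. by rewrite -(vl_lerD2rE z x) subrK. Qed.

Lemma vl_subr_ge0 x y : (0 <= y - x) = (x <= y).
Proof. by rewrite vl_lerBrD add0r. Qed.

Lemma vl_lerN2 x y : (- x <= - y) = (y <= x).
Proof. by rewrite -(vl_subr_ge0 (- x)) opprK addrC vl_subr_ge0. Qed.

Lemma vl_lerD x y z t : x <= y -> z <= t -> x + z <= y + t.
Proof.
move=> xy zt; apply: (@le_trans _ _ (y + z)); first exact: vl_lerD2r.
by rewrite !(addrC y); exact: vl_lerD2r.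
Qed.

Lemma vl_ler_pscale a x y : 0 < a -> (a *: x <= a *: y) = (x <= y).
Proof.
move=> a0; apply/idP/idP => [h|]; last exact/vl_ler_scale/ltW.
have := vl_ler_scale (ltW (etrans (invr_gt0 a) a0)) h.
by rewrite !scalerA mulVf ?gt_eqF// !scale1r.
Qed.

Lemma vl_scale_ge0 a x : 0 <= a -> 0 <= x -> 0 <= a *: x.
Proof. by move=> a0 x0; rewrite -(scaler0 _ a); exact: vl_ler_scale. Qed.

Lemma vl_ler_wscale x a b : 0 <= x -> a <= b -> a *: x <= b *: x.
Proof.
by move=> x0 ab; rewrite -vl_subr_ge0 -scalerBl vl_scale_ge0 ?subr_ge0.
Qed.

Lemma vl_meetDr z x y : ((x `&` y) + z = (x + z) `&` (y + z))%O.
Proof.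
apply/le_anti/andP; split.
  by rewrite lexI !vl_lerD2rE leIl leIr.
by rewrite -vl_lerBDr lexI !vl_lerBDr leIl leIr.
Qed.

Lemma vl_oppI x y : (- (x `&` y) = (- x) `|` (- y))%O.
Proof.
apply/le_anti/andP; split.
  by rewrite -vl_lerN2 opprK lexI -(opprK x) -(opprK y) !vl_lerN2 !opprK leUl leUr.
by rewrite leUx !vl_lerN2 leIl leIr.
Qed.

Lemma vl_oppU x y : (- (x `|` y) = (- x) `&` (- y))%O.
Proof. by rewrite -{1}(opprK x) -{1}(opprK y) -vl_oppI opprK. Qed.

Lemma vl_joinDr z x y : ((x `|` y) + z = (x + z) `|` (y + z))%O.
Proof.
apply: oppr_inj; rewrite opprD vl_oppU vl_meetDr vl_oppU.
by rewrite !opprD.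
Qed.

Lemma vl_addUI x y : ((x `|` y) + (x `&` y) = x + y)%O.
Proof.
rewrite -[x in (x `&` _)%O]opprK -[y in (_ `&` y)%O]opprK -vl_oppU.
apply/eqP; rewrite subr_eq; apply/eqP.
by rewrite (joinC (- x)%R) [RHS]addrC vl_joinDr addrCA addNr addr0 addrA addNr add0r.
Qed.

Lemma vl_scaleU a x y : 0 < a -> (a *: (x `|` y) = (a *: x) `|` (a *: y))%O.
Proof.
move=> a0; have aE z : z = a *: (a^-1 *: z).
  by rewrite scalerA divff ?gt_eqF// scale1r.
apply/le_anti/andP; split; last by rewrite leUx !vl_ler_pscale// leUl leUr.
by rewrite [leRHS]aE vl_ler_pscale// leUx -(vl_ler_pscale x _ a0)
  -(vl_ler_pscale y _ a0) -aE leUl leUr.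
Qed.

Lemma vl_scaleI a x y : 0 < a -> (a *: (x `&` y) = (a *: x) `&` (a *: y))%O.
Proof.
move=> a0; apply: oppr_inj.
by rewrite -scalerN !vl_oppI vl_scaleU// !scalerN.
Qed.

(** Since [a = (a /\ z) + (a \/ z) - z], an upper bound [b] of the elements [a /\ z] yields the
    upper bound [b - z + (x \/ z)] of [X]. Finite distributivity is then the case of a pair. *)
Lemma supremums_meetr (X : set E) x z : supremums X x ->
  supremums [set (a `&` z)%O | a in X] (x `&` z)%O.
Proof.
move=> [ux lx]; split => [_ [a Xa <-]|b ub]; first by rewrite leI2// ux.
have /lx : ubound X (b - z + (x `|` z)%O).
  move=> a Xa; rewrite addrAC vl_lerBrD -(vl_addUI a) [leLHS]addrC.
  apply: vl_lerD; first by apply: ub; exists a.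
  by apply: leU2 => //; exact: ux.
by rewrite addrAC vl_lerBrD -(vl_addUI x) [leLHS]addrC vl_lerD2rE.
Qed.

Lemma vl_meetUr x y z : ((x `|` y) `&` z = (x `&` z) `|` (y `&` z))%O.
Proof.
apply/le_anti/andP; split; last by rewrite leUx !leI2 ?leUl ?leUr.
have [//|_] := @supremums_meetr [set x; y] (x `|` y)%O z.
  split=> [_ [->|->]|b ub]; rewrite ?leUl ?leUr// leUx !ub//; [by right|by left].
by apply=> _ [_ [->|->] <-]; rewrite ?leUl ?leUr.
Qed.

Lemma vl_joinIr x y z : ((x `&` y) `|` z = (x `|` z) `&` (y `|` z))%O.
Proof. by apply: oppr_inj; rewrite !(vl_oppU, vl_oppI) vl_meetUr. Qed.

Lemma vl_disjoint x y : (x `&` y = 0)%O ->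
  ((x - y) `|` 0 = x)%O /\ ((x - y) `&` 0 = - y)%O.
Proof.
move=> xy; split.
  by rewrite -(subrr y) -vl_joinDr -[(x `|` y)%O]addr0 -xy vl_addUI addrK.
by rewrite -[X in (_ `&` X)%O](subrr y) -vl_meetDr xy add0r.
Qed.

(** By distributivity the meet is [(x /\ -x) \/ 0], and [x /\ -x = -|x| <= 0] because
    [2 |x| >= x + (-x) = 0]. *)
Lemma vl_posneg_disjoint x : ((x `|` 0) `&` (- (x `&` 0)) = 0)%O.
Proof.
rewrite vl_oppI oppr0 -vl_joinIr join_r//.
have -> : (x `&` - x)%O = - (x `|` - x)%O by rewrite vl_oppU opprK meetC.
rewrite -[leRHS]oppr0 vl_lerN2 -(@vl_ler_pscale 2)// scaler0 scaler_nat mulr2n.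
rewrite -{1}(subrr x).
by apply: vl_lerD; rewrite ?leUl ?leUr.
Qed.

(** Enlarging both coefficients to [1 + a] bounds the meet by [(1 + a) *: (x /\ y)]. *)
Lemma vl_disjointZ a x y : 0 <= a -> 0 <= x -> 0 <= y ->
  (x `&` y = 0)%O -> (x `&` (a *: y) = 0)%O.
Proof.
move=> a0 x0 y0 xy; have a1 : 0 < 1 + a by rewrite ltr_pwDl.
apply/le_anti; rewrite lexI x0 vl_scale_ge0// !andbT.
rewrite -[leRHS](scaler0 _ (1 + a)) -xy vl_scaleI//; apply: leI2.
  by rewrite -[leLHS]scale1r vl_ler_wscale// lerDl.
by rewrite vl_ler_wscale// lerDr.
Qed.

(** Archimedean property: adding [x] to a positive multiple of [x] gives another one, so if [s] is
    the supremum of these multiples then [s - x] is still an upper bound. *)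
Lemma vl_archi (hE : dedekind_complete E) x z :
  (forall n : nat, n.+1%:R *: x <= z) -> x <= 0.
Proof.
move=> h; have [|//|s [us ls]] := hE [set n.+1%:R *: x | n in [set: nat]].
- by exists (1 *: x); exists 0%N.
- by exists z => _ [n _ <-].
suff : s <= s - x by rewrite vl_lerBrD -[leRHS]addr0 !(addrC s) vl_lerD2rE.
apply: ls => _ [n _ <-]; rewrite vl_lerBrD -[x in _ + x](@scale1r R) -scalerDl -natr1.
by rewrite natr1 natr1; apply: us; exists n.+1.
Qed.

End VectorLattice.

(** * The ordered cone of cuts *)

Section Cuts.
Context {R : realType} (E : vectorLatticeType R).
Implicit Types (x y z : E) (a b : R).

Definition cut_axiom (A : set E) : Prop :=
  [/\ A !=set0, forall x y, x <= y -> A y -> A x &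
      forall X x, X !=set0 -> X `<=` A -> supremums X x -> A x].

Record cut := Cut { cut_set :> E -> Prop ; cutP : cut_axiom cut_set }.

Lemma cut_ext (A B : cut) : (forall x, A x <-> B x) -> A = B.
Proof.
case: A B => [A pA] [B pB] /= AB.
have eAB : A = B by apply/seteqP; split=> x /AB.
by move: pA pB; rewrite eAB => pA pB; congr Cut; exact: Prop_irrelevance.
Qed.

HB.instance Definition _ := gen_eqMixin cut.
HB.instance Definition _ := gen_choiceMixin cut.

Implicit Types A B C D : cut.

Lemma cut_ne (C : cut) : exists x, C x.
Proof. by have [] := cutP C. Qed.

Lemma cut_le (C : cut) x y : x <= y -> C y -> C x.
Proof. by have [_ h _] := cutP C; exact: h. Qed.

Lemma cut_sup (C : cut) (X : set E) x :
  X !=set0 -> X `<=` cut_set C -> supremums X x -> C x.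
Proof. by have [_ _] := cutP C; exact. Qed.

Lemma cut_join (C : cut) x y : C x -> C y -> C (x `|` y)%O.
Proof.
move=> Cx Cy; apply: (@cut_sup C [set x; y]); first by exists x; left.
  by move=> _ [->|->].
split=> [_ [->|->]|b ub]; rewrite ?leUl ?leUr// leUx !ub//; by [right|left].
Qed.

(** Makes generated cuts available: joins, sums and suprema are intersections of all cuts containing
    the generators, and nonemptiness is the only thing left to check. *)
Lemma cut_bigcap (T : Type) (P : T -> Prop) (F : T -> cut) :
  (exists x, forall t, P t -> F t x) ->
  cut_axiom [set x | forall t, P t -> F t x].
Proof.
move=> [x0 Px0]; split; first by exists x0.
- by move=> x y xy Py t /Py; exact: cut_le.
- move=> X x X0 XP supX t Pt; apply: (cut_sup X0 _ supX) => y Xy.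
  exact: XP.
Qed.

Lemma cut_dn_subproof x : cut_axiom [set y | y <= x].
Proof.
split; first by exists x => /=.
- by move=> y z yz /= zx; exact: le_trans zx.
- by move=> X y _ Xx [_ +]; apply.
Qed.
Definition cut_dn x : cut := Cut (cut_dn_subproof x).

(* Translations, homotheties and the maps [x |-> x /\ z] have preimages of cuts
   that are cuts. An inclusion of a generated cut in another one is checked
   below by finding an intersection of such preimages that contains the
   generators. *)
Lemma cut_meetby_subproof (C : cut) z : cut_axiom [set x | C (x `&` z)%O].
Proof.
split.
- by have [c Cc] := cut_ne C; exists c => /=; apply: cut_le Cc; exact: leIl.
- by move=> x y xy; apply: cut_le; rewrite leI2.
- move=> X x [x0 Xx0] XC /(supremums_meetr z); apply: cut_sup.
    by exists (x0 `&` z)%O, x0.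
  by move=> _ [y Xy <-]; exact: XC.
Qed.
Definition cut_meetby C z := Cut (cut_meetby_subproof C z).

Lemma supremums_bij (f g : E -> E) (X : set E) x :
  cancel f g -> cancel g f -> {homo f : x y / x <= y} ->
  {homo g : x y / x <= y} -> supremums X x -> supremums (f @` X) (f x).
Proof.
move=> fK gK fle gle [ux lx]; split=> [_ [y Xy <-]|b ub].
  by apply: fle; exact: ux.
by rewrite -(gK b); apply/fle/lx => y Xy; rewrite -(fK y); apply/gle/ub; exists y.
Qed.

Lemma cut_preimage_subproof (f g : E -> E) (C : cut) :
  cancel f g -> cancel g f -> {homo f : x y / x <= y} ->
  {homo g : x y / x <= y} -> cut_axiom [set x | C (f x)].
Proof.
move=> fK gK fle gle; split.
- by have [c Cc] := cut_ne C; exists (g c) => /=; rewrite gK.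
- by move=> x y /fle; exact: cut_le.
- move=> X x [x0 Xx0] XC /(supremums_bij fK gK fle gle); apply: cut_sup.
    by exists (f x0), x0.
  by move=> _ [y Xy <-]; exact: XC.
Qed.

Definition cut_shift (C : cut) z : cut :=
  Cut (@cut_preimage_subproof (+%R^~ z) (+%R^~ (- z)) C
    (addrK z) (subrK z) (vl_lerD2r z) (vl_lerD2r (- z))).

Lemma cut_homoth_subproof (C : cut) a : 0 < a -> cut_axiom [set x | C (a *: x)].
Proof.
move=> a0; apply: (@cut_preimage_subproof _ ( *:%R a^-1)).
- by move=> x; rewrite scalerA mulVf ?gt_eqF// scale1r.
- by move=> x; rewrite scalerA divff ?gt_eqF// scale1r.
- by move=> x y; apply/vl_ler_scale/ltW.
- by move=> x y; apply: vl_ler_scale; rewrite invr_ge0 ltW.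
Qed.

Definition cle (A B : cut) : bool := `[< cut_set A `<=` cut_set B >].

Lemma cle_refl : reflexive cle.
Proof. by move=> A; apply/asboolP. Qed.

Lemma cle_anti : antisymmetric cle.
Proof.
by move=> A B /andP[/asboolP AB /asboolP BA]; apply: cut_ext => x; split=> [/AB|/BA].
Qed.

Lemma cle_trans : transitive cle.
Proof.
by move=> B A C /asboolP AB /asboolP BC; apply/asboolP => x /AB /BC.
Qed.

HB.instance Definition _ := Order.Le_isPOrder.Build ring_display cut
  cle_refl cle_anti cle_trans.

Lemma cut_leP (A B : cut) : reflect (forall x, A x -> B x) (A <= B).
Proof. exact: asboolP. Qed.

Lemma cut_meet_subproof (A B : cut) : cut_axiom [set x | A x /\ B x].
Proof.
rewrite (_ : [set _ | _] = 
    [set x | forall b : bool, True -> (if b then A else B) x]).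
  apply: cut_bigcap; have [x Ax] := cut_ne A; have [y By] := cut_ne B.
  by exists (x `&` y)%O => -[] _;
    [exact: cut_le (leIl _ _) Ax|exact: cut_le (leIr _ _) By].
apply/seteqP; split=> x /=; first by move=> [Ax Bx] [].
by move=> h; split; [exact: (h true)|exact: (h false)].
Qed.
Definition cut_meet A B := Cut (cut_meet_subproof A B).

Lemma cut_join_subproof (A B : cut) :
  cut_axiom [set x | forall D : cut, A <= D /\ B <= D -> D x].
Proof.
apply: cut_bigcap; have [x Ax] := cut_ne A.
by exists x => D [/cut_leP AD _]; exact: AD.
Qed.
Definition cut_sup2 A B := Cut (cut_join_subproof A B).

Lemma cut_lexI (A B C : cut) : (A <= cut_meet B C) = (A <= B) && (A <= C).
Proof.
apply/idP/andP => [/cut_leP h|[/cut_leP AB /cut_leP AC]].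
  by split; apply/cut_leP => x /h [].
by apply/cut_leP => x Ax; split; [exact: AB|exact: AC].
Qed.

Lemma cut_leUx (A B C : cut) : (cut_sup2 A B <= C) = (A <= C) && (B <= C).
Proof.
apply/idP/andP => [/cut_leP h|h]; last by apply/cut_leP => x; exact.
by split; apply/cut_leP => x Ax; apply: h => D [/cut_leP AD /cut_leP BD];
  [exact: AD|exact: BD].
Qed.

HB.instance Definition _ := Order.POrder_MeetJoin_isLattice.Build ring_display cut
  cut_lexI cut_leUx.

Lemma cut_dn_le x (C : cut) : (cut_dn x <= C) <-> C x.
Proof.
split=> [/cut_leP|Cx]; first by apply => /=.
by apply/cut_leP => y; move/cut_le; apply.
Qed.

Lemma cut_meetE (A B : cut) x : (A `&` B)%O x <-> A x /\ B x.
Proof. by []. Qed.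

(** A generated cut is accessible only through the cuts that contain it, so identities between sums
    and joins are proved by comparing upper bounds. *)
Lemma cut_leEub (A B : cut) : (forall D, A <= D <-> B <= D) -> A = B.
Proof. by move=> h; apply/le_anti/andP; split; apply/h. Qed.

Lemma cut_add_subproof (A B : cut) :
  cut_axiom [set z | forall D : cut,
    (forall x y, A x -> B y -> D (x + y)) -> D z].
Proof.
apply: cut_bigcap; have [x Ax] := cut_ne A; have [y By] := cut_ne B.
by exists (x + y) => D h; exact: h.
Qed.
Definition cut_add A B := Cut (cut_add_subproof A B).

Lemma cut_add_leP (A B D : cut) :
  (cut_add A B <= D) <-> (forall x y, A x -> B y -> D (x + y)).
Proof.
split=> [/cut_leP h a b Aa Bb|h]; first by apply: h => F; exact.
by apply/cut_leP => x; exact.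
Qed.

Lemma cut_addP (A B : cut) x y : A x -> B y -> cut_add A B (x + y).
Proof. by move=> Aa Bb D; exact. Qed.

Lemma cut_addC : commutative cut_add.
Proof.
move=> A B; apply: cut_leEub => D; rewrite !cut_add_leP.
by split=> h a b Aa Bb; rewrite addrC; exact: h.
Qed.

Lemma cut_addA : associative cut_add.
Proof.
move=> A B C; apply: cut_leEub => D; rewrite !cut_add_leP; split=> h.
  move=> d c + Cc; move: d; apply/(@cut_leP _ (cut_shift D c))/cut_add_leP.
  by move=> a b Aa Bb /=; rewrite -addrA; apply: h => //; exact: cut_addP.
move=> a d Aa; rewrite addrC; move: d.
apply/(@cut_leP _ (cut_shift D a))/cut_add_leP.
move=> b c Bb Cc /=; rewrite addrC addrA; apply: h => //; exact: cut_addP.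
Qed.

Lemma cut_add0 : left_id (cut_dn 0) cut_add.
Proof.
move=> A; apply: cut_leEub => D; rewrite cut_add_leP; split=> [h|/cut_leP AD].
  by apply/cut_leP => x Ax; rewrite -[x]add0r; apply: h => //=.
move=> x y /= x0 /AD; apply: cut_le.
by rewrite -[leRHS]add0r vl_lerD2rE.
Qed.

(* The product by [0] is the neutral element, even for the cut [setT]; a
   negative scalar gives the same junk value. *)
Definition cut_scale a (C : cut) : cut :=
  if pselect (0 < a) is left a0
  then Cut (cut_homoth_subproof C (etrans (invr_gt0 a) a0))
  else cut_dn 0.

Lemma cut_scaleE a (C : cut) x : 0 < a -> cut_scale a C x <-> C (a^-1 *: x).
Proof. by rewrite /cut_scale; case: pselect. Qed.

Lemma cut_scale_le0 a (C : cut) : a <= 0 -> cut_scale a C = cut_dn 0.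
Proof.
move=> a_le0; rewrite /cut_scale; case: pselect => // a0.
by have := lt_le_trans a0 a_le0; rewrite ltxx.
Qed.

Lemma cut_scale0 (C : cut) : cut_scale 0 C = cut_dn 0.
Proof. exact: cut_scale_le0. Qed.

Lemma cut_scale_dn a x : 0 <= a -> cut_scale a (cut_dn x) = cut_dn (a *: x).
Proof.
rewrite le0r => /orP[/eqP->|a0]; first by rewrite cut_scale0 scale0r.
apply: cut_ext => y; rewrite cut_scaleE//= -(vl_ler_pscale _ _ a0).
by rewrite scalerA divff ?gt_eqF// scale1r.
Qed.

Lemma cut_scaleP a (C : cut) x : 0 <= a -> C x -> cut_scale a C (a *: x).
Proof.
rewrite le0r => /orP[/eqP-> _|a0 Cx]; first by rewrite cut_scale0 scale0r /=.
by rewrite cut_scaleE// scalerA mulVf ?gt_eqF// scale1r.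
Qed.

Lemma cut_scale_leP a (C D : cut) : 0 < a ->
  (cut_scale a C <= D) <-> (forall x, C x -> D (a *: x)).
Proof.
move=> a0; split=> [/cut_leP h x Cx|h]; first exact/h/cut_scaleP/Cx/ltW.
apply/cut_leP => x /(cut_scaleE _ _ a0)/h.
by rewrite scalerA divff ?gt_eqF// scale1r.
Qed.

Lemma cut_scaleA a b (C : cut) : 0 <= a -> 0 <= b ->
  cut_scale a (cut_scale b C) = cut_scale (a * b) C.
Proof.
move=> a0; rewrite le0r => /orP[/eqP->|b0].
  by rewrite mulr0 cut_scale0 cut_scale_dn// scaler0.
move: a0; rewrite le0r => /orP[/eqP->|a0]; first by rewrite mul0r !cut_scale0.
apply: cut_ext => x; rewrite !cut_scaleE ?mulr_gt0// scalerA invfM mulrC.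
by [].
Qed.

Lemma cut_scale1 (C : cut) : cut_scale 1 C = C.
Proof. by apply: cut_ext => x; rewrite cut_scaleE// invr1 scale1r. Qed.

HB.instance Definition _ :=
  isSemistar.Build R cut cut_scaleA cut_scale1 cut_scale0.

Lemma cut_ler_scale a (A B : cut) : 0 <= a -> A <= B -> a *! A <= a *! B.
Proof.
rewrite le0r => /orP[/eqP->|a0 /cut_leP AB]; first by rewrite !sscale0.
by apply/cut_leP => x; rewrite !cut_scaleE//; exact: AB.
Qed.

HB.instance Definition _ := Semistar_isOrdered.Build R cut cut_ler_scale.

Lemma cut_scaleDr a (A B : cut) : 0 <= a ->
  a *! cut_add A B = cut_add (a *! A) (a *! B).
Proof.
rewrite le0r => /orP[/eqP->|a0]; first by rewrite !sscale0 cut_add0.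
apply: cut_leEub => D; rewrite cut_scale_leP// cut_add_leP; split=> h.
  move=> x y /(cut_scaleE _ _ a0) Ax /(cut_scaleE _ _ a0) By.
  have := h _ (cut_addP Ax By).
  by rewrite scalerDr !scalerA !divff ?gt_eqF// !scale1r.
apply/(@cut_leP _ (Cut (cut_homoth_subproof D a0)))/cut_add_leP => x y Ax By /=.
by rewrite scalerDr; apply: h; apply: cut_scaleP => //; exact: ltW.
Qed.

Lemma cut_scaleDl a b (C : cut) : 0 <= a -> 0 <= b ->
  (a + b) *! C = cut_add (a *! C) (b *! C).
Proof.
rewrite le0r => /orP[/eqP-> _|a0]; first by rewrite sscale0 add0r cut_add0.
rewrite le0r => /orP[/eqP->|b0].
  by rewrite sscale0 addr0 cut_addC cut_add0.
have ab0 : 0 < a + b by rewrite addr_gt0.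
apply: cut_leEub => D; rewrite cut_scale_leP// cut_add_leP; split=> h.
  move=> x y /(cut_scaleE _ _ a0) Cx /(cut_scaleE _ _ b0) Cy.
  (* Directedness of cuts: [a x' + b y' <= (a + b) (x' \/ y')] for the members [x' = a^-1 x] and
     [y' = b^-1 y] of [C]. *)
  apply: cut_le (h _ (cut_join Cx Cy)).
  rewrite scalerDl vl_lerD//.
    by rewrite -[leLHS]scale1r -(divff (lt0r_neq0 a0)) -scalerA vl_ler_pscale// leUl.
  by rewrite -[leLHS]scale1r -(divff (lt0r_neq0 b0)) -scalerA vl_ler_pscale// leUr.
move=> x Cx; rewrite scalerDl; apply: h; apply: cut_scaleP => //; exact: ltW.
Qed.

HB.instance Definition _ :=
  Semistar_isCone.Build R cut cut_addA cut_addC cut_add0 cut_scaleDr cut_scaleDl.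

Lemma cut_ler_add2r (C A B : cut) : A <= B -> A +! C <= B +! C.
Proof.
move=> /cut_leP AB; apply/cut_add_leP => a b /AB; exact: cut_addP.
Qed.

HB.instance Definition _ := Cone_isOrdered.Build R cut cut_ler_add2r.

End Cuts.

Lemma supremums_unique d (T : porderType d) (X : set T) x :
  supremums X x -> supremums X = [set x].
Proof.
by move=> Xx; apply/seteqP; split=> [y Xy|_ -> //]; exact: is_subset1_supremums Xy Xx.
Qed.

(** * The cuts form a sup-completion *)

Section SupCompletion.
Context {R : realType} {E : vectorLatticeType R}.
Implicit Types (x y z : E) (a b : R) (A B C D : cut E).

Lemma cut_supremum (F : set (cut E)) : F !=set0 -> supremums F !=set0.
Proof.
move=> [A0 FA0].
have cutF : cut_axiom [set x | forall D, (forall A, F A -> A <= D) -> D x].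
  apply: cut_bigcap; have [x Ax] := cut_ne A0; exists x => D h.
  exact: (cut_leP _ _ (h _ FA0)).
exists (Cut cutF); split=> [A FA|D uD]; last by apply/cut_leP => x; exact.
by apply/cut_leP => x Ax D h; exact: (cut_leP _ _ (h _ FA)).
Qed.

(** For [x] in [C] and [D], the cut [cut_meetby B x] contains every [A] of [F], as [y /\ x] lies in
    [A] and [D] for [y] in [A]. So it contains [C], in particular [x], and [x = x /\ x] lies in
    [B]. *)
Lemma cut_supremums_meetr (F : set (cut E)) C D : supremums F C ->
  supremums [set (A `&` D)%O | A in F] (C `&` D)%O.
Proof.
move=> [uC lC]; split=> [_ [A FA <-]|B uB]; first by rewrite leI2// uC.
apply/cut_leP => x [Cx Dx]; rewrite -[x]meetxx; move: Cx.
apply/(@cut_leP _ _ _ (cut_meetby B x))/lC => A FA; apply/cut_leP => y Ay /=.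
have /cut_leP : (A `&` D)%O <= B by apply: uB; exists A.
by apply; split; [exact: cut_le (leIl _ _) Ay|exact: cut_le (leIr _ _) Dx].
Qed.

Lemma cut_meetUl :
  left_distributive (@Order.meet _ (cut E)) (@Order.join _ (cut E)).
Proof.
move=> A B D; apply/le_anti/andP; split; last by rewrite leUx !leI2 ?leUl ?leUr.
have [//|_] := @cut_supremums_meetr [set A; B] (A `|` B)%O D.
  split=> [_ [->|->]|b ub]; rewrite ?leUl ?leUr// leUx !ub//; [by right|by left].
by apply=> _ [_ [->|->] <-]; rewrite ?leUl ?leUr.
Qed.

HB.instance Definition _ :=
  Order.Lattice_Meet_isDistrLattice.Build ring_display (cut E) cut_meetUl.

Lemma cut_dnD x y : cut_dn (x + y) = cut_dn x +! cut_dn y.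
Proof.
apply: cut_leEub => D; rewrite cut_dn_le cut_add_leP; split=> [Dxy u v ux vy|].
  by apply: cut_le Dxy; exact: vl_lerD.
by apply=> /=.
Qed.

Lemma cut_dnZ a x : 0 <= a -> a *! cut_dn x = cut_dn (a *: x).
Proof. exact: cut_scale_dn. Qed.

Lemma cut_dn_leE x y : (cut_dn x <= cut_dn y) = (x <= y).
Proof. by apply/idP/idP => [/cut_dn_le|xy]; last exact/cut_dn_le. Qed.

Lemma cut_dnI x y : cut_dn (x `&` y)%O = (cut_dn x `&` cut_dn y)%O.
Proof.
by apply: cut_ext => z; rewrite cut_meetE/= lexI; split=> [/andP|[-> ->]].
Qed.

Lemma cut_dnU x y : cut_dn (x `|` y)%O = (cut_dn x `|` cut_dn y)%O.
Proof.
apply: cut_leEub => D; rewrite cut_dn_le leUx; split=> [Dxy|/andP[]].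
  by apply/andP; split; apply/cut_dn_le; apply: cut_le Dxy; rewrite ?leUl ?leUr.
by move=> /cut_dn_le Dx /cut_dn_le Dy; exact: cut_join.
Qed.

Lemma cut_dn_inj : injective (@cut_dn R E).
Proof. by move=> x y xy; apply/le_anti; rewrite -!cut_dn_leE xy lexx. Qed.

Lemma cut_dn_sup (C : cut E) :
  supremums [set z | range (@cut_dn R E) z /\ z <= C] C.
Proof.
split=> [_ [_ //]|D uD]; apply/cut_leP => x Cx; apply/cut_dn_le.
by apply: uD; split; [exists x|exact/cut_dn_le].
Qed.

Hypothesis hE : dedekind_complete E.

(** Dedekind completeness provides the supremum of [C], and the closure axiom puts it into [C]. *)
Lemma cut_bounded C x : C <= cut_dn x -> exists y, C = cut_dn y.
Proof.
move=> /cut_leP Cx; have [||y sy] := hE (A := cut_set C).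
- by have [c Cc] := cut_ne C; exists c.
- by exists x => c /Cx.
exists y; apply/le_anti/andP; split; first by apply/cut_leP; exact: sy.1.
apply/cut_dn_le; apply: (cut_sup _ _ sy) => //.
by have [c Cc] := cut_ne C; exists c.
Qed.

Lemma cut_is_sup_completion : is_sup_completion (@cut_dn R E).
Proof.
split.
- by move=> F F0 _; exact: cut_supremum.
- apply/seteqP; split=> [_ [x _ <-]|A [B AB]] /=.
    by exists (cut_dn (- x)); rewrite -cut_dnD subrr.
  (* An invertible cut is bounded: if [A +! B] is zero, then [x + b <= 0] for all [x] in [A]. *)
  have [b Bb] := cut_ne B.
  have [|x ->] := @cut_bounded A (- b); last by exists x.
  apply/cut_leP => x Ax /=; rewrite -[leRHS]add0r vl_lerBrD.
  have : (A +! B) (x + b) := cut_addP Ax Bb.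
  by rewrite AB.
- exact: cut_dnD.
- by move=> a x a0; rewrite cut_dnZ.
- exact: cut_dn_leE.
- exact: cut_dn_sup.
- move=> x B Z; apply/le_anti/andP; split.
    rewrite lexI; apply/andP.
    by split; apply/cut_add_leP => u v Zu [xv Bv]; exact: cut_addP.
  apply/cut_leP => w [Zxw].
  set D := Z +! (cut_dn x `&` B)%O.
  (* Adding a principal cut is a mere translation. *)
  have Zw : Z (w - x).
    apply/(@cut_leP _ _ _ (cut_shift Z (- x)))/cut_add_leP: Zxw => u v Zu /= vx.
    by apply: cut_le Zu; rewrite vl_lerBDr; exact: vl_lerD.
  (* It suffices that [(z + y) /\ w] lies in [D] for [z] in [Z] and [y] in [B]; it is at most
     [(z \/ (w - x)) + (x /\ y)], a sum of a member of [Z] and a member of [cut_dn x /\ B]. *)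
  rewrite -[X in D X]meetxx -[X in (_ `&` X)%O](subrK x).
  apply/(@cut_leP _ _ _ (cut_meetby D (w - x + x)))/cut_add_leP => z y Zz By /=.
  apply: cut_le (_ : D ((z `|` (w - x)) + (x `&` y)))%O.
    rewrite [leRHS]addrC vl_meetDr lexI.
    apply/andP; split; [apply: le_trans (leIr _ _) _|apply: le_trans (leIl _ _) _];
      by rewrite [leRHS]addrC vl_lerD ?leUl ?leUr.
  apply: cut_addP; first exact: cut_join.
  by split; [exact: leIl|exact: cut_le (leIr _ _) By].
- by move=> x B /cut_bounded[y ->]; exists y.
- have cutT : cut_axiom (fun _ : E => True) by split=> //; exists 0.
  by exists (Cut cutT) => A; exact/cut_leP.
- move=> F G F0 G0 FG x; have [C sC] := cut_supremum F0.
  rewrite (supremums_unique (cut_supremums_meetr (cut_dn x) sC)).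
  move: sC; rewrite FG => sC.
  by rewrite (supremums_unique (cut_supremums_meetr (cut_dn x) sC)).
Qed.

End SupCompletion.

(** * Calculus in lattice semistars and lattice stars *)

Section Semistars.
Context {R : realType} {S : latticeSemistarType R}.
Implicit Types (x y : S) (a : R).

Lemma sscaler0_nneg a : 0 <= a -> a *! szero = szero :> S.
Proof. by move=> a0; rewrite -(sscale0 szero) sscaleA_nneg// mulr0. Qed.

Lemma sscaleK a : 0 < a -> cancel (@sscale R S a) (@sscale R S a^-1).
Proof.
by move=> a0 x; rewrite sscaleA_nneg ?invr_ge0 ?ltW// mulVf ?gt_eqF// sscale1.
Qed.

Lemma sscaleVK a : 0 < a -> cancel (@sscale R S a^-1) (@sscale R S a).
Proof.
by move=> a0 x; rewrite sscaleA_nneg ?invr_ge0 ?ltW// divff ?gt_eqF// sscale1.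
Qed.

Lemma ler_psscale a x y : 0 < a -> (a *! x <= a *! y) = (x <= y).
Proof.
move=> a0; apply/idP/idP => [h|]; last exact/ler_sscale/ltW.
by rewrite -(sscaleK a0 x) -(sscaleK a0 y) ler_sscale// invr_ge0 ltW.
Qed.

Lemma sscaleU a x y : 0 <= a -> a *! (x `|` y)%O = ((a *! x) `|` (a *! y))%O.
Proof.
rewrite le0r => /orP[/eqP->|a0]; first by rewrite !sscale0 joinxx.
apply/le_anti/andP; split; last by rewrite leUx !ler_psscale// leUl leUr.
rewrite -[leRHS](sscaleVK a0) ler_psscale// leUx.
by rewrite -(@ler_psscale a x)// -(@ler_psscale a y)// sscaleVK// leUl leUr.
Qed.

Lemma sscaleI a x y : 0 <= a -> a *! (x `&` y)%O = ((a *! x) `&` (a *! y))%O.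
Proof.
rewrite le0r => /orP[/eqP->|a0]; first by rewrite !sscale0 meetxx.
apply/le_anti/andP; split; first by rewrite lexI !ler_psscale// leIl leIr.
rewrite -[leLHS](sscaleVK a0) ler_psscale// lexI.
by rewrite -(@ler_psscale a _ x)// -(@ler_psscale a _ y)// sscaleVK// leIl leIr.
Qed.

End Semistars.

Section Stars.
Context {R : realType} {S : latticeStarType R}.
Implicit Types (x y : S) (a : R).

Lemma soppK : involutive (@sopp R S).
Proof. by move=> x; rewrite /sopp sscaleA mulN1r opprK sscale1. Qed.

Lemma ler_sopp2 x y : (sopp x <= sopp y) = (y <= x).
Proof.
apply/idP/idP => [h|]; last exact: ler_sscaleN1.
by rewrite -(soppK x) -(soppK y); exact: ler_sscaleN1.
Qed.

Lemma soppU x y : sopp (x `|` y)%O = (sopp x `&` sopp y)%O.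
Proof.
apply/le_anti/andP; split; first by rewrite lexI !ler_sopp2 leUl leUr.
rewrite -ler_sopp2 soppK leUx; apply/andP.
by split; rewrite -ler_sopp2 soppK ?leIl ?leIr.
Qed.

Lemma soppI x y : sopp (x `&` y)%O = (sopp x `|` sopp y)%O.
Proof. by rewrite -[LHS]soppK -[RHS]soppK soppU !soppK. Qed.

Lemma sscaler0 a : a *! szero = szero :> S.
Proof. by rewrite -(sscale0 szero) sscaleA mulr0. Qed.

Lemma sopp0 : sopp szero = szero :> S.
Proof. exact: sscaler0. Qed.

Lemma sneg_spos x : sneg x = spos (sopp x).
Proof. by rewrite /sneg /spos soppI sopp0. Qed.

Lemma spos_opp x : spos (sopp x) = sneg x.
Proof. by rewrite sneg_spos. Qed.

Lemma sposZ a x : 0 <= a -> spos (a *! x) = a *! spos x.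
Proof. by move=> a0; rewrite /spos sscaleU// sscaler0. Qed.

Lemma spos_ge0 x : szero <= spos x.
Proof. exact: leUr. Qed.

Lemma sneg_ge0 x : szero <= sneg x.
Proof. by rewrite sneg_spos spos_ge0. Qed.

Lemma spos_id x : szero <= x -> spos x = x.
Proof. by move=> x0; rewrite /spos join_l. Qed.

Lemma sneg_eq0 x : szero <= x -> sneg x = szero.
Proof. by move=> x0; rewrite /sneg meet_r// sopp0. Qed.

Lemma spos_le x y : x <= y -> spos x <= spos y.
Proof. by move=> xy; rewrite leU2. Qed.

Lemma sneg_le x y : x <= y -> sneg y <= sneg x.
Proof. by move=> xy; rewrite ler_sopp2 leI2. Qed.

(** By distributivity the meet is [0 \/ (x /\ -x)], and [x /\ -x = -|x| <= 0] is valuatedness. *)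
Lemma spos_neg_disjoint : is_distributive S -> is_valuated S ->
  forall x, (spos x `&` sneg x)%O = szero.
Proof.
move=> dS vS x; rewrite sneg_spos /spos dS (meet_r (leUr _ _)).
rewrite join_r// meetC dS leUx leIr andbT.
by have := vS x; rewrite -ler_sopp2 /sabs soppU sopp0 soppK.
Qed.

End Stars.

(** An order embedding onto a subset closed under joins and meets preserves both. The map [phi]
    inverts [psi] on [T] and takes the default value [szero] elsewhere. *)
Lemma semistar_embedding_iso_on (R : realType) (S C : latticeSemistarType R)
    (T : set S) (psi : C -> S) :
  (forall x y, T x -> T y -> T (x `|` y)%O) ->
  (forall x y, T x -> T y -> T (x `&` y)%O) ->
  range psi = T ->
  (forall y z, (psi y <= psi z) = (y <= z)) ->
  (forall a y, 0 <= a -> psi (a *! y) = a *! psi y) ->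
  exists phi : S -> C, lattice_semistar_iso_on T phi.
Proof.
move=> TU TI psiT psile psiZ.
have psiI : injective psi.
  by move=> y z yz; apply/le_anti; rewrite -!psile yz lexx.
have Tpsi y : T (psi y) by rewrite -psiT; exists y.
have psiU y z : psi (y `|` z)%O = (psi y `|` psi z)%O.
  apply/le_anti/andP; split; last by rewrite leUx !psile leUl leUr.
  have [w _ we] : range psi (psi y `|` psi z)%O by rewrite psiT; exact: TU.
  by rewrite -we psile leUx -!psile we leUl leUr.
have psiM y z : psi (y `&` z)%O = (psi y `&` psi z)%O.
  apply/le_anti/andP; split; first by rewrite lexI !psile leIl leIr.
  have [w _ we] : range psi (psi y `&` psi z)%O by rewrite psiT; exact: TI.
  by rewrite -we psile lexI -!psile we leIl leIr.
exists (fun s => xget szero [set y | psi y = s]).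
have psiK y : xget szero [set z | psi z = psi y] = y.
  by apply: xget_unique => // z /psiI.
rewrite -psiT; split.
- split=> [//|_ _ /set_mem[y _ <-] /set_mem[z _ <-]|y _].
    by rewrite !psiK => ->.
  by exists (psi y); [exists y|rewrite psiK].
- by move=> a _ a0 [y _ <-]; rewrite -psiZ// !psiK.
- by move=> _ _ [y _ <-] [z _ <-]; rewrite -psiU !psiK.
- by move=> _ _ [y _ <-] [z _ <-]; rewrite -psiM !psiK.
Qed.

Lemma join_setP (R : realType) (E : vectorLatticeType R)
    (S : latticeStarType R) (i : E -> S) s :
  join_set i s <-> exists x, i x <= s.
Proof.
split=> [[t [x ->]]|[x xs]]; first by exists x; exact: leUr.
by exists s, x; rewrite join_l.
Qed.

Lemma join_setU (R : realType) (E : vectorLatticeType R)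
    (S : latticeStarType R) (i : E -> S) s t :
  join_set i s -> join_set i (s `|` t)%O.
Proof.
move=> /join_setP[x xs]; apply/join_setP.
by exists x; exact: le_trans (leUl _ _).
Qed.

Lemma join_setI (R : realType) (E : vectorLatticeType R)
    (S : latticeStarType R) (i : E -> S) s t : lattice_substar_embedding i ->
  join_set i s -> join_set i t -> join_set i (s `&` t)%O.
Proof.
move=> [_ _ _ iI] /join_setP[x xs] /join_setP[y yt]; apply/join_setP.
by exists (x `&` y)%O; rewrite iI leI2.
Qed.

(** * The model: disjoint pairs of nonnegative cuts *)

Section CutPairs.
Context {R : realType} (E : vectorLatticeType R).
Implicit Types (x y z : E) (a b : R) (A B C D : cut E).

Record cut_pair := CutPair {
  cp_pos : cut E ;
  cp_neg : cut E ;
  cp_pos_ge0 : szero <= cp_pos ;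
  cp_neg_ge0 : szero <= cp_neg ;
  cp_disjoint : (cp_pos `&` cp_neg)%O = szero
}.
Implicit Types s t u : cut_pair.

Lemma cut_pair_eq s t : cp_pos s = cp_pos t -> cp_neg s = cp_neg t -> s = t.
Proof.
case: s t => [A B A0 B0 AB] [A' B' A'0 B'0 AB'] /= eA eB.
move: A'0 B'0 AB'; rewrite -eA -eB => A'0 B'0 AB'.
by congr CutPair; exact: Prop_irrelevance.
Qed.

HB.instance Definition _ := gen_eqMixin cut_pair.
HB.instance Definition _ := gen_choiceMixin cut_pair.

Definition cp_le s t := (cp_pos s <= cp_pos t) && (cp_neg t <= cp_neg s).

Lemma cp_le_refl : reflexive cp_le.
Proof. by move=> s; rewrite /cp_le !lexx. Qed.

Lemma cp_le_anti : antisymmetric cp_le.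
Proof.
move=> s t /andP[/andP[p1 n1] /andP[p2 n2]].
by apply: cut_pair_eq; apply/le_anti/andP.
Qed.

Lemma cp_le_trans : transitive cp_le.
Proof.
move=> t s u /andP[p1 n1] /andP[p2 n2].
by apply/andP; split; [exact: le_trans p2|exact: le_trans n1].
Qed.

HB.instance Definition _ := Order.Le_isPOrder.Build ring_display cut_pair
  cp_le_refl cp_le_anti cp_le_trans.

Lemma cp_leE s t : (s <= t) = (cp_pos s <= cp_pos t) && (cp_neg t <= cp_neg s).
Proof. by []. Qed.

Lemma cp_disjointC s : (cp_neg s `&` cp_pos s)%O = szero.
Proof. by rewrite meetC cp_disjoint. Qed.

Definition cp_swap s : cut_pair :=
  CutPair (cp_neg_ge0 s) (cp_pos_ge0 s) (cp_disjointC s).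

Lemma disjoint_cutUI A B A' B' : szero <= B -> szero <= B' ->
  (A `&` B)%O = szero -> (A' `&` B')%O = szero ->
  ((A `|` A') `&` (B `&` B'))%O = szero.
Proof.
move=> B0 B'0 AB AB'; rewrite meetUl meetA AB.
by rewrite (meetC B) meetA AB' (meet_l B'0) (meet_l B0) joinxx.
Qed.

Definition cp_join s t : cut_pair.
Proof.
apply: (@CutPair (cp_pos s `|` cp_pos t)%O (cp_neg s `&` cp_neg t)%O).
- by apply: le_trans (leUl _ _); exact: cp_pos_ge0.
- by rewrite lexI !cp_neg_ge0.
- by apply: disjoint_cutUI; rewrite ?cp_neg_ge0 ?cp_disjoint.
Defined.

Definition cp_meet s t := cp_swap (cp_join (cp_swap s) (cp_swap t)).

Lemma cp_lexI s t u : (s <= cp_meet t u) = (s <= t) && (s <= u).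
Proof. by rewrite !cp_leE/= lexI leUx andbACA. Qed.

Lemma cp_leUx s t u : (cp_join s t <= u) = (s <= u) && (t <= u).
Proof. by rewrite !cp_leE/= lexI leUx andbACA. Qed.

HB.instance Definition _ := Order.POrder_MeetJoin_isLattice.Build ring_display
  cut_pair cp_lexI cp_leUx.

Definition cp_zero : cut_pair := CutPair (lexx szero) (lexx szero) (meetxx szero).

Definition cp_pscale a (a0 : 0 <= a) s : cut_pair.
Proof.
apply: (@CutPair (a *! cp_pos s) (a *! cp_neg s)).
- by rewrite -(sscaler0_nneg a0) ler_sscale// cp_pos_ge0.
- by rewrite -(sscaler0_nneg a0) ler_sscale// cp_neg_ge0.
- by rewrite -sscaleI// cp_disjoint sscaler0_nneg.
Defined.

(** A negative scalar acts by its absolute value after exchanging the parts, as [(-x)^+ = x^-]. *)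
Definition cp_scale a s : cut_pair :=
  cp_pscale (normr_ge0 a) (if 0 <= a then s else cp_swap s).

Lemma cp_scaleA a b s : cp_scale a (cp_scale b s) = cp_scale (a * b) s.
Proof.
have [->|a0] := eqVneq a 0.
  by rewrite mul0r; apply: cut_pair_eq; rewrite /= normr0 lexx !sscale0.
have [->|b0] := eqVneq b 0.
  rewrite mulr0 /cp_scale lexx.
  by case: ifP => _; apply: cut_pair_eq; rewrite /= normr0 !sscale0 sscaler0_nneg.
(* With zero scalars settled, two swaps cancel and one survives, as the sign of the product
   prescribes. *)
have sgn : (0 <= a * b) = ((0 <= a) == (0 <= b)).
  have [a_gt0|a_lt0|/eqP] := ltrgt0P a; last by rewrite (negbTE a0).
    by rewrite pmulr_rge0//; case: (0 <= b).
  by rewrite nmulr_rge0// leNgt lt_neqAle eq_sym b0; case: (0 <= b).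
rewrite /cp_scale sgn; case: (0 <= a); case: (0 <= b); apply: cut_pair_eq;
  by rewrite /= sscaleA_nneg// normrM.
Qed.

Lemma cp_scale1 s : cp_scale 1 s = s.
Proof. by apply: cut_pair_eq; rewrite /= normr1 ler01 sscale1. Qed.

Lemma cp_scale0 s : cp_scale 0 s = cp_zero.
Proof. by apply: cut_pair_eq; rewrite /= normr0 lexx sscale0. Qed.

HB.instance Definition _ := isSemistar.Build R cut_pair
  (fun a b s _ _ => cp_scaleA a b s) cp_scale1 cp_scale0.

HB.instance Definition _ := Semistar_isStar.Build R cut_pair cp_scaleA.

Lemma cp_posZ a s : 0 <= a -> cp_pos (a *! s) = a *! cp_pos s.
Proof. by move=> a0; rewrite /= a0 ger0_norm. Qed.

Lemma cp_negZ a s : 0 <= a -> cp_neg (a *! s) = a *! cp_neg s.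
Proof. by move=> a0; rewrite /= a0 ger0_norm. Qed.

Lemma cp_ler_scale a s t : 0 <= a -> s <= t -> a *! s <= a *! t.
Proof.
move=> a0 /andP[p n].
by rewrite cp_leE !cp_posZ// !cp_negZ// !ler_sscale.
Qed.

HB.instance Definition _ := Semistar_isOrdered.Build R cut_pair cp_ler_scale.

Lemma cp_scaleN1 s : (-1 : R) *! s = cp_swap s.
Proof.
by apply: cut_pair_eq; rewrite /= normrN1 oppr_ge0 leNgt ltr01/= sscale1.
Qed.

Lemma cp_ler_scaleN1 s t : s <= t -> (-1 : R) *! t <= (-1 : R) *! s.
Proof. by rewrite !cp_scaleN1 !cp_leE andbC. Qed.

HB.instance Definition _ := Star_isOrdered.Build R cut_pair cp_ler_scaleN1.

Lemma cp_sposE s : cp_pos (spos s) = cp_pos s /\ cp_neg (spos s) = szero.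
Proof.
split; first by rewrite /= (join_l (cp_pos_ge0 s)).
by rewrite /= (meet_r (cp_neg_ge0 s)).
Qed.

Lemma cp_distributive : is_distributive cut_pair.
Proof.
by move=> s t u; apply: cut_pair_eq => /=; [exact: meetUr|exact: joinIr].
Qed.

Lemma cp_valuated : is_valuated cut_pair.
Proof.
move=> s; rewrite /sabs /sopp cp_scaleN1 cp_leE/=.
rewrite cp_disjointC lexx andbT; apply: le_trans (leUl _ _).
exact: cp_pos_ge0.
Qed.

(** Positive parts are joined and negative parts intersected; the results are disjoint because cuts
    distribute over infinite suprema. *)
Lemma cp_dedekind : dedekind_complete cut_pair.
Proof.
move=> G [s0 Gs0] _.
have [A supA] : supremums (cp_pos @` G) !=set0.
  by apply: cut_supremum; exists (cp_pos s0), s0.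
have cutB : cut_axiom [set x | forall s, G s -> cp_neg s x].
  by apply: cut_bigcap; exists 0 => s _; apply/cut_dn_le; exact: cp_neg_ge0.
have A0 : szero <= A.
  by apply: le_trans (cp_pos_ge0 s0) _; apply: supA.1; exists s0.
have B0 : szero <= Cut cutB.
  by apply/cut_leP => x x0 s _; exact: (cut_leP _ _ (cp_neg_ge0 s)).
have AB : (A `&` Cut cutB)%O = szero.
  apply/le_anti; rewrite lexI A0 B0 !andbT.
  apply: (cut_supremums_meetr (Cut cutB) supA).2 => _ [_ [s Gs <-] <-].
  rewrite -(cp_disjoint s) leI2//.
  by apply/cut_leP => x; exact.
exists (CutPair A0 B0 AB); split=> [s Gs|t ut].
  rewrite cp_leE/=; apply/andP; split; first by apply: supA.1; exists s.
  by apply/cut_leP => x; exact.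
rewrite cp_leE/=; apply/andP; split.
  by apply: supA.2 => _ [s /ut/andP[st _] <-].
by apply/cut_leP => x tx s /ut/andP[_ /cut_leP]; exact.
Qed.

Lemma cp_emb_disjoint x :
  (cut_dn (x `|` 0)%O `&` cut_dn (- (x `&` 0)%O))%O = szero.
Proof. by rewrite -cut_dnI vl_posneg_disjoint. Qed.

Lemma cp_emb_pos_ge0 x : szero <= cut_dn (x `|` 0)%O.
Proof. by rewrite cut_dn_leE leUr. Qed.

Lemma cp_emb_neg_ge0 x : szero <= cut_dn (- (x `&` 0)%O).
Proof. by rewrite cut_dn_leE -vl_lerN2 opprK oppr0 leIr. Qed.

Definition cp_emb x : cut_pair :=
  CutPair (cp_emb_pos_ge0 x) (cp_emb_neg_ge0 x) (cp_emb_disjoint x).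

Lemma cp_emb_swap x : cp_emb (- x) = cp_swap (cp_emb x).
Proof.
by apply: cut_pair_eq => /=; rewrite ?vl_oppI ?oppr0 ?opprK.
Qed.

Lemma cp_embU x y : cp_emb (x `|` y)%O = (cp_emb x `|` cp_emb y)%O.
Proof.
apply: cut_pair_eq => /=; first by rewrite -cut_dnU joinACA joinxx.
by rewrite -cut_dnI -vl_oppU vl_meetUr.
Qed.

Lemma cp_embZ_nneg a x : 0 <= a -> cp_emb (a *: x) = a *! cp_emb x.
Proof.
rewrite le0r => /orP[/eqP->|a0].
  by rewrite scale0r sscale0; apply: cut_pair_eq; rewrite /= ?joinxx ?meetxx ?oppr0.
apply: cut_pair_eq; rewrite ?cp_posZ ?cp_negZ ?(ltW a0)//= cut_dnZ ?ltW//.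
  by rewrite vl_scaleU// scaler0.
by rewrite scalerN vl_scaleI// scaler0.
Qed.

Lemma cp_embZ a x : cp_emb (a *: x) = a *! cp_emb x.
Proof.
have [a0|a0] := leP 0 a; first exact: cp_embZ_nneg.
rewrite -[a]opprK scaleNr cp_emb_swap cp_embZ_nneg ?oppr_ge0 ?ltW//.
by rewrite -cp_scaleN1 sscaleA mulN1r.
Qed.

Lemma cp_emb_inj : injective cp_emb.
Proof.
move=> x y xy; rewrite -[x]addr0 -(vl_addUI x) -[y]addr0 -(vl_addUI y).
have /cut_dn_inj-> : cut_dn (x `|` 0)%O = cut_dn (y `|` 0)%O := congr1 cp_pos xy.
have : cut_dn (- (x `&` 0)%O) = cut_dn (- (y `&` 0)%O) := congr1 cp_neg xy.
by move=> /cut_dn_inj/oppr_inj->.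
Qed.

Lemma cp_emb_substar : lattice_substar_embedding cp_emb.
Proof.
split; [exact: cp_emb_inj|exact: cp_embZ|exact: cp_embU|move=> x y].
rewrite -[LHS]soppK /sopp !cp_scaleN1 -cp_emb_swap vl_oppI cp_embU.
by rewrite !cp_emb_swap.
Qed.

Lemma cp_emb_ge0 x : 0 <= x ->
  cp_pos (cp_emb x) = cut_dn x /\ cp_neg (cp_emb x) = szero.
Proof. by move=> x0; rewrite /= join_l// meet_r// oppr0. Qed.

Lemma cp_pos_belowP s x : pos_below cp_emb (spos s) x <-> 0 <= x /\ cp_pos s x.
Proof.
have e : 0 <= x -> (cp_emb x <= spos s) = (cut_dn x <= cp_pos s).
  move=> x0; rewrite cp_leE (cp_sposE s).1 (cp_sposE s).2 (cp_emb_ge0 x0).1.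
  by rewrite (cp_emb_ge0 x0).2 lexx andbT.
split=> -[x0 sx]; split=> //; first by apply/cut_dn_le; rewrite -e.
by rewrite e//; exact/cut_dn_le.
Qed.

Lemma cp_neg_belowP s x : pos_below cp_emb (sneg s) x <-> 0 <= x /\ cp_neg s x.
Proof. by rewrite sneg_spos /sopp cp_scaleN1; exact: cp_pos_belowP. Qed.

(** Members [x >= 0] and [y >= 0] of the two parts of [s] are disjoint, so [x - y] is embedded as
    the pair of [cut_dn x] and [cut_dn y]. The infimum over [y] is the pair of [cut_dn x] and [s^-],
    that is, [s /\ cp_emb x]. *)
Lemma cp_sup_inf : sup_inf_representation cp_emb.
Proof.
move=> s; exists (fun x => (s `&` cp_emb x)%O); split.
  move=> x /cp_pos_belowP[x0 sx].
  have embB y : 0 <= y -> cp_neg s y ->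
      cp_pos (cp_emb (x - y)) = cut_dn x /\ cp_neg (cp_emb (x - y)) = cut_dn y.
    move=> y0 sy; have xy : (x `&` y = 0)%O.
      apply/le_anti; rewrite lexI x0 y0 !andbT.
      rewrite -cut_dn_leE -[leRHS](cp_disjoint s) cut_dnI.
      by apply: leI2; exact/cut_dn_le.
    by have [/= -> ->] := vl_disjoint xy; rewrite opprK.
  have s0 : cp_neg s 0 by apply/cut_dn_le; exact: cp_neg_ge0.
  split=> [_ [y /cp_neg_belowP[y0 sy] <-]|t ht].
    have [ep en] := embB y y0 sy; rewrite cp_leE ep en /= join_l// leIr/=.
    by apply: le_trans (leUl _ _); exact/cut_dn_le.
  have ht' y : 0 <= y -> cp_neg s y -> cp_pos t <= cut_dn x /\ cut_dn y <= cp_neg t.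
    move=> y0 sy; have [ep en] := embB y y0 sy; apply/andP.
    by rewrite -ep -en -cp_leE; apply: ht; exists y => //; exact/cp_neg_belowP.
  rewrite lexI cp_leE [X in _ && X]cp_leE (cp_emb_ge0 x0).1.
  rewrite (cp_emb_ge0 x0).2 cp_neg_ge0 andbT.
  have [tx _] := ht' 0 (lexx 0) s0; rewrite tx andbT; apply/andP; split.
    by apply: le_trans tx _; exact/cut_dn_le.
  (* The formula ranges over nonnegative members only, hence the passage to [y \/ 0]. *)
  apply/cut_leP => y sy; have [||_ /cut_leP] := ht' (y `|` 0)%O.
  - exact: leUr.
  - exact: cut_join.
  - by apply => /=; exact: leUl.
split=> [_ [x _ <-]|t ht]; first exact: leIl.
have ht' x : 0 <= x -> cp_pos s x -> (s `&` cp_emb x)%O <= t.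
  by move=> x0 sx; apply: ht; exists x => //; exact/cp_pos_belowP.
have s0 : cp_pos s 0 by apply/cut_dn_le; exact: cp_pos_ge0.
rewrite cp_leE; apply/andP; split; last first.
  have := ht' 0 (lexx _) s0; rewrite cp_leE => /andP[_ /le_trans]; apply.
  by rewrite /= meetxx oppr0 leUx lexx cp_neg_ge0.
apply/cut_leP => x sx; have [|| /cut_leP] := andP (ht' (x `|` 0)%O _ _).
- exact: leUr.
- exact: cut_join.
move=> + _; apply; apply: (@cut_le _ _ _ _ (x `|` 0)%O); first exact: leUl.
by split; [exact: cut_join|exact: leUl].
Qed.

(** The negative part of a cut, as the infimum of [y^-] over its members. When [C /\ 0 = cut_dn m],
    it is [cut_dn (- m)]. *)
Lemma cut_neg_subproof C :
  cut_axiom [set x | forall y, C y -> x <= - (y `&` 0)%O].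
Proof.
apply: (@cut_bigcap _ _ _ C (fun y => cut_dn (- (y `&` 0)%O))).
by exists 0 => y _ /=; rewrite -vl_lerN2 opprK oppr0 leIr.
Qed.
Definition cut_neg C : cut E := Cut (cut_neg_subproof C).

Lemma cut_neg_ge0 C : szero <= cut_neg C.
Proof.
apply/cut_leP => x /= x0 y _; apply: le_trans x0 _.
by rewrite -vl_lerN2 opprK oppr0 leIr.
Qed.

(** For [x] in [cut_neg C] it is enough to meet [x] with the generators of [C \/ 0]: if [y] is in
    [C], then [y /\ x <= y^+ /\ y^- = 0]. *)
Lemma cut_neg_disjoint C : ((C `|` szero) `&` cut_neg C)%O = szero.
Proof.
apply/le_anti/andP; split; last by rewrite lexI leUr cut_neg_ge0.
apply/cut_leP => x [Cx nx]; rewrite -[x]meetxx.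
move: Cx; apply/(@cut_leP _ _ _ (cut_meetby (cut_dn 0) x)).
rewrite leUx; apply/andP; split; apply/cut_leP => y /=; last first.
  by apply: le_trans; exact: leIl.
move=> /nx xy; rewrite -(vl_posneg_disjoint y).
by apply: leI2 => //; exact: leUl.
Qed.

Definition cut_to_pair C : cut_pair :=
  CutPair (leUr szero C) (cut_neg_ge0 C) (cut_neg_disjoint C).

Lemma cut_to_pairZ a C : 0 <= a -> cut_to_pair (a *! C) = a *! cut_to_pair C.
Proof.
rewrite le0r => /orP[/eqP->|a0].
  rewrite !sscale0; apply: cut_pair_eq; first by rewrite /= joinxx.
  apply: cut_ext => x /=; split=> [/(_ 0 (lexx _))|x0 y y0].
    by rewrite meetxx oppr0.
  by apply: le_trans x0 _; rewrite -vl_lerN2 opprK oppr0 leIr.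
have aK x : a *: (a^-1 *: x) = x by rewrite scalerA divff ?gt_eqF// scale1r.
apply: cut_pair_eq; rewrite ?cp_posZ ?cp_negZ ?ltW//=.
  by rewrite sscaleU ?ltW// (sscaler0_nneg (ltW a0)).
apply: cut_ext => x; rewrite cut_scaleE//=; split=> h y.
  move=> Cy; rewrite -(vl_ler_pscale _ _ a0) aK scalerN vl_scaleI// scaler0.
  by apply: h; exact: cut_scaleP (ltW a0) Cy.
move=> /(cut_scaleE _ _ a0)/h.
by rewrite -(vl_ler_pscale _ _ a0) aK scalerN vl_scaleI// scaler0 aK.
Qed.

Hypothesis hE : dedekind_complete E.

(** Let [x] be in [C]. The negative parts give [x /\ 0 <= m] for the greatest element [m] of
    [D /\ 0], so [x /\ 0] is in [D]. The positive parts put [x \/ 0] in [D \/ 0], whose generators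
    all fall into [D] when met with [x]; hence so does [(x \/ 0) /\ x = x]. *)
Lemma cut_to_pair_le C D : (cut_to_pair C <= cut_to_pair D) = (C <= D).
Proof.
apply/idP/idP => [/andP[/= CD /cut_leP DC]|CD]; last first.
  rewrite cp_leE/= leU2//=.
  by apply/cut_leP => x nx y Cy; apply: nx; exact: (cut_leP _ _ CD).
apply/cut_leP => x Cx.
have [m Dm] := cut_bounded hE (leIr (cut_dn 0) D).
have Dx : D (x `&` 0)%O.
  have : (D `&` cut_dn 0)%O m by rewrite Dm /=.
  move=> [+ _]; apply: cut_le; rewrite -vl_lerN2.
  apply: (DC (- m)) Cx => y Dy; rewrite vl_lerN2.
  have : (D `&` cut_dn 0)%O (y `&` 0)%O.
    by split; [exact: cut_le (leIl _ _) Dy|exact: leIr].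
  by rewrite Dm.
rewrite -(meet_r (leUl x 0)).
have : (D `|` cut_dn 0)%O (x `|` 0)%O.
  apply: (cut_leP _ _ CD); apply: cut_join; first exact: (cut_leP _ _ (leUl _ _)).
  by apply: (cut_leP _ _ (leUr _ C)) => /=.
apply/(@cut_leP _ _ _ (cut_meetby D x)); rewrite leUx; apply/andP.
split; apply/cut_leP => y /=; first exact/cut_le/leIl.
by move=> y0; apply: cut_le Dx; rewrite meetC leI2.
Qed.

Lemma range_cut_to_pair : range cut_to_pair = join_set cp_emb.
Proof.
apply/seteqP; split=> [_ [C _ <-]|s /join_setP[x]].
  have [y Cy] := cut_ne C; apply/join_setP; exists y; rewrite cp_leE /=.
  rewrite cut_dnU leU2 //=; last exact/cut_dn_le.
  by apply/cut_leP => z; exact.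
rewrite cp_leE => /andP[_ /(cut_bounded hE)[b sb]].
have b0 : 0 <= b by rewrite -cut_dn_leE -sb; exact: cp_neg_ge0.
have sI y : cp_pos s y -> y <= b -> y <= 0.
  move=> sy yb; rewrite -cut_dn_leE -[leRHS](cp_disjoint s) sb.
  by rewrite lexI cut_dn_leE yb andbT; exact/cut_dn_le.
have s0 : cp_pos s 0 by apply/cut_dn_le; exact: cp_pos_ge0.
(* With [s^- = cut_dn b], the preimage of [s] is [s^+ - b]. *)
exists (cut_shift (cp_pos s) b) => //; apply: cut_pair_eq => /=.
  apply/le_anti/andP; split.
    rewrite leUx cp_pos_ge0 andbT; apply/cut_leP => y /=; apply: cut_le.
    by rewrite -[leLHS]addr0 !(addrC y) vl_lerD2rE.
  apply/cut_leP => y sy; apply: (@cut_le _ _ _ _ (y `|` 0)%O); first exact: leUl.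
  have sy0 : cp_pos s (y `|` 0)%O by exact: cut_join.
  have yb : ((y `|` 0) `&` b = 0)%O.
    apply/le_anti; rewrite lexI leUr b0 !andbT.
    by apply: sI (leIr _ _); exact: cut_le (leIl _ _) sy0.
  (* Being disjoint from [b], the element [y \/ 0] is the positive part of [(y \/ 0) - b]. *)
  rewrite -(vl_disjoint yb).1; apply: cut_join.
    by apply: (cut_leP _ _ (leUl _ _)); rewrite /= subrK.
  by apply: (cut_leP _ _ (leUr _ _)) => /=.
rewrite sb; apply: cut_ext => y /=; split=> [/(_ (- b))|yb z sz].
  by rewrite addNr meet_l ?opprK; [apply|rewrite -vl_lerN2 opprK oppr0].
apply: le_trans yb _; rewrite -vl_lerN2 opprK -[leRHS]add0r vl_lerBrD.
by rewrite vl_meetDr add0r; apply: sI (leIr _ _); exact: cut_le (leIl _ _) sz.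
Qed.

Lemma cp_is_star_completion : is_star_completion cp_emb.
Proof.
split.
- exact: cp_dedekind.
- exact: cp_distributive.
- exact: cp_valuated.
- exact: cp_emb_substar.
- have [phi phiP] := semistar_embedding_iso_on (psi := cut_to_pair)
    (fun s t Ts _ => join_setU t Ts) (fun s t => join_setI cp_emb_substar)
    range_cut_to_pair cut_to_pair_le cut_to_pairZ.
  exists (cut E), (@cut_dn R E), phi; split => //.
  exact: cut_is_sup_completion.
- exact: cp_sup_inf.
Qed.

End CutPairs.

(** * Consequences of the axioms of a sup-completion *)

Section SupCompletionTheory.
Context {R : realType} {E : vectorLatticeType R} {C : latticeConeType R}.
Context {j : E -> C} (jC : is_sup_completion j).
Implicit Types (x y z : E) (a b c d t w : C).

Lemma sc_zero : j 0 = szero.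
Proof. by rewrite -(scale0r 0) (sc_scale jC)// sscale0. Qed.

Lemma sc_dense_le c d : (forall x, j x <= c -> j x <= d) -> c <= d.
Proof.
by move=> h; apply: (sc_dense jC c).2 => _ [[x _ <-]]; exact: h.
Qed.

(** The axiom [sc_meet] covers meets with elements of [E]; density extends it to [d]. For [j x]
    below [c] and [d], comparing [F] with the singleton of [c] shows that [j x] is the supremum of
    the [a /\ j x], each below [a /\ d]. *)
Lemma sc_supremums_meetr (F : set C) c d : F !=set0 -> supremums F c ->
  supremums [set (a `&` d)%O | a in F] (c `&` d)%O.
Proof.
move=> F0 Fc; split=> [_ [a Fa <-]|b ub]; first by rewrite leI2// Fc.1.
apply: sc_dense_le => x; rewrite lexI => /andP[xc xd].
have := sc_meet jC F0 (B := [set c]) (ex_intro _ c erefl) _ x.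
rewrite supremums1 (supremums_unique Fc) => /(_ erefl).
rewrite (_ : [set _ | b in [set c]] = [set (c `&` j x)%O]) ?image_set1//.
rewrite supremums1.
rewrite (meet_r xc) => /(congr1 (fun P => P (j x)))/= e.
have [_ lx] : supremums [set (a `&` j x)%O | a in F] (j x) by rewrite e.
apply: lx => _ [a Fa <-]; apply: (@le_trans _ _ (a `&` d)%O); first exact: leI2.
by apply: ub; exists a.
Qed.

(** The witness [w] stands for [(k e - t)^+], where [e] is an element of [E] below [c] but not below
    [t]. No multiple of [w] can lift its meet with [t] above [k e]. *)
Lemma sc_gap (hE : dedekind_complete E) t c :
  szero <= t -> szero <= c -> ~ (c <= t) ->
  exists w, [/\ szero <= w, ~ (w <= szero), w <= c &
    exists2 k : R, 0 < k < 1 &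
      forall r : R, 0 <= r -> (t `&` (r *! w))%O <= k *! c].
Proof.
move=> t0 c0 ct.
have jle := sc_le jC.
have [e [e0 ec et]] : exists e : E, [/\ 0 <= e, j e <= c & ~ (j e <= t)].
  apply: contrapT => ne; apply: ct; apply: sc_dense_le => x xc.
  apply: contrapT => xt; apply: ne.
  have [|e _ ee] := sc_ideal jC (x := (x `|` 0)%O) (y := (j x `|` szero)%O).
    by rewrite leUx -sc_zero !jle leUl leUr.
  exists e; rewrite -jle ee sc_zero leUr leUx xc c0; split=> //.
  by move=> /(le_trans (leUl _ _)).
have [b _ be] := sc_ideal jC (leIr (j e) t).
(* Ratios tending to 1. If [k n *: e <= t] for all [n], then [b = t /\ e] satisfies
   [(n + 1) (e - b) <= b] for all [n], and the Archimedean property gives [e <= b]. *)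
pose k n : R := n.+1%:R / n.+2%:R.
have k01 n : 0 < k n < 1.
  by rewrite divr_gt0 ?ltr0n//= ltr_pdivrMr ?ltr0n// mul1r ltr_nat.
have [n nt] : exists n, ~ (j (k n *: e) <= t).
  apply: contrapT => ne.
  have h n : k n *: e <= b.
    rewrite -jle be lexI; apply/andP; split.
      by apply: contrapT => knt; apply: ne; exists n.
    rewrite jle -[leRHS]scale1r vl_ler_wscale// ltW//.
    by have /andP[] := k01 n.
  apply: et; rewrite -(subrK b e); apply: le_trans (leIl t (j e)).
  rewrite -be jle.
  rewrite -[leRHS]add0r vl_lerD2rE; apply: (vl_archi hE (z := b)) => n.
  rewrite scalerBr vl_lerBDr -{1}[b]scale1r -scalerDl addrC natr1.
  rewrite -(@vl_ler_pscale _ _ n.+2%:R^-1) ?invr_gt0 ?ltr0n// !scalerA.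
  rewrite mulVf ?pnatr_eq0// scale1r.
  by rewrite mulrC; exact: h.
have [k0 k1] := andP (k01 n); set d := k n *: e in nt.
have d0 : 0 <= d by rewrite vl_scale_ge0// ltW.
have [b' _ b'e] := sc_ideal jC (leIr (j d) t).
have b'0 : 0 <= b' by rewrite -jle b'e sc_zero lexI t0 -sc_zero jle.
have b'd : b' <= d by rewrite -jle b'e leIr.
(* Since [t] need not lie in [E], [(d - t)^+] is written as [d - (t /\ d)]. *)
exists (j (d - b')); split.
- by rewrite -sc_zero jle vl_subr_ge0.
- rewrite -sc_zero jle vl_lerBDr add0r => db; apply: nt.
  by apply: le_trans (leIl t (j d)); rewrite -b'e jle.
- apply: le_trans ec; rewrite jle vl_lerBDr.
  apply: (@le_trans _ _ (e + 0)); last by rewrite !(addrC e) vl_lerD2rE.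
  by rewrite addr0 -[leRHS]scale1r vl_ler_wscale// ltW.
exists (k n) => [|r r0]; first exact: k01.
rewrite -(sc_scale jC)//.
have [t' _ t'e] := sc_ideal jC (leIr (j (r *: (d - b'))) t).
apply: (@le_trans _ _ (k n *! j e)); last by apply: ler_sscale => //; exact: ltW.
rewrite -(sc_scale jC) ?(ltW k0)// -t'e jle.
have w0 : 0 <= d - b' by rewrite vl_subr_ge0.
have t'0 : 0 <= t'.
  by rewrite -jle t'e sc_zero lexI t0 -sc_zero jle vl_scale_ge0.
have t'w : t' <= r *: (d - b') by rewrite -jle t'e leIr.
have t't : j t' <= t by rewrite t'e leIl.
(* The disjoint parts of [t' - d]. From [t' /\ d <= b'] follows [d - b' <= q], so
   [p <= t' <= r *: (d - b') <= r *: q] forces [p = 0], which means [t' <= d]. *)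
pose p := ((t' - d) `|` 0)%O; pose q := (- ((t' - d) `&` 0))%O.
have wq : d - b' <= q.
  rewrite -vl_lerN2 opprK opprB vl_lerBrD vl_meetDr subrK add0r.
  by rewrite -jle b'e lexI jle leIr andbT; apply: le_trans t't; rewrite jle leIl.
have pt' : p <= t'.
  by rewrite leUx t'0 andbT vl_lerBDr -[leLHS]addr0 !(addrC t') vl_lerD2rE.
have q0 : 0 <= q by rewrite -vl_lerN2 opprK oppr0 leIr.
have p0 : 0 <= p by exact: leUr.
have p_le0 : p <= 0.
  rewrite -(vl_disjointZ r0 p0 q0 (vl_posneg_disjoint _)) lexI lexx /=.
  by apply: le_trans pt' _; apply: le_trans t'w _; exact: vl_ler_scale.
have : t' - d <= 0 by apply: le_trans p_le0; exact: leUl.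
by rewrite vl_lerBDr add0r.
Qed.

End SupCompletionTheory.

(** * An arbitrary completion is isomorphic to the model *)

Section Completion.
Context {R : realType} {E : vectorLatticeType R} (hE : dedekind_complete E).
Context {S : latticeStarType R} {i : E -> S} (Si : is_star_completion i).
Implicit Types (x y z : E) (s t u v : S).

Let dS := star_distributive Si.
Let vS := star_valuated Si.

Lemma emb_inj : injective i.
Proof. by have [] := star_substar Si. Qed.

Lemma embZ (a : R) x : i (a *: x) = a *! i x.
Proof. by have [] := star_substar Si. Qed.

Lemma embU x y : i (x `|` y)%O = (i x `|` i y)%O.
Proof. by have [] := star_substar Si. Qed.

Lemma embI x y : i (x `&` y)%O = (i x `&` i y)%O.
Proof. by have [] := star_substar Si. Qed.

Lemma emb0 : i 0 = szero.
Proof. by rewrite -(scale0r 0) embZ sscale0. Qed.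

Lemma embN x : i (- x) = sopp (i x).
Proof. by rewrite -scaleN1r embZ. Qed.

Lemma emb_le x y : (i x <= i y) = (x <= y).
Proof.
apply/idP/idP => [/meet_idPl|/meet_idPl xy].
  by rewrite -embI => /emb_inj <-; exact: leIr.
by rewrite -xy embI leIr.
Qed.

(** As [u^-] is zero, the inner infimum in (ii) runs over [y = 0] alone. *)
Lemma star_sup_inf_nneg u : szero <= u ->
  supremums [set i x | x in [set x | 0 <= x /\ i x <= u]] u.
Proof.
move=> u0; have [f [finf fsup]] := star_sup_inf Si u.
have fE x : pos_below i u x -> f x = i x.
  move=> ux; have [|lf gf] := finf x; first by rewrite spos_id.
  have y0 y : pos_below i (sneg u) y -> y = 0.
    move=> [y_ge0]; rewrite sneg_eq0// -emb0 emb_le => y_le0.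
    by apply/le_anti; rewrite y_le0 y_ge0.
  apply/le_anti/andP; split.
    apply: lf; exists 0; rewrite ?subr0//; split=> //.
    by rewrite emb0 sneg_ge0.
  by apply: gf => _ [y /y0-> <-]; rewrite subr0.
move: fsup; rewrite spos_id//.
rewrite (_ : [set f x | x in _] =
  [set i x | x in [set x | 0 <= x /\ i x <= u]])//.
by apply/seteqP; split=> _ [x ux <-]; exists x; rewrite ?fE.
Qed.

Lemma star_nneg_le u v : szero <= u ->
  (forall x, 0 <= x -> i x <= u -> i x <= v) -> u <= v.
Proof.
by move=> u0 h; apply: (star_sup_inf_nneg u0).2 => _ [x [x0 xu] <-]; exact: h.
Qed.

(** The right side of (ii) grows with the positive part and decreases with the negative part. *)
Lemma star_leP s t : (s <= t) = (spos s <= spos t) && (sneg t <= sneg s).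
Proof.
apply/idP/andP => [st|[p n]]; first by split; [exact: spos_le|exact: sneg_le].
have [f [finf fsup]] := star_sup_inf Si s.
have [g [ginf gsup]] := star_sup_inf Si t.
apply: fsup.2 => _ [x xs <-].
have xt : pos_below i (spos t) x.
  by case: xs => x0 xs; split=> //; exact: le_trans p.
apply: (@le_trans _ _ (g x)); last by apply: gsup.1; exists x.
apply: (ginf x xt).2 => _ [y [y0 yt] <-].
by apply: (finf x xs).1; exists y => //; split=> //; exact: le_trans n.
Qed.

Definition upper := join_set i.

Lemma upperP s : upper s <-> exists x, i x <= s.
Proof. exact: join_setP. Qed.

Lemma upper_le s t : s <= t -> upper s -> upper t.
Proof.
by move=> st /upperP[x xs]; apply/upperP; exists x; exact: le_trans st.
Qed.

Lemma upper_emb x : upper (i x).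
Proof. by apply/upperP; exists x. Qed.

Lemma upper_nneg s : szero <= s -> upper s.
Proof. by rewrite -emb0 => s0; apply/upperP; exists 0. Qed.

Section Iso.
Context {C : latticeConeType R} {j : E -> C} {phi : S -> C}.
Context (jC : is_sup_completion j) (phiP : lattice_semistar_iso_on upper phi).

Lemma iso_le s t : upper s -> upper t -> (phi s <= phi t) = (s <= t).
Proof.
have [[_ phiI _] _ phiU _] := phiP => us ut; apply/idP/idP.
  move=> /join_idPl; rewrite -phiU// => /phiI.
  rewrite !inE => <- //; [exact: leUr|exact: join_setU].
by move=> /join_idPl <-; rewrite phiU// leUr.
Qed.

Lemma iso_surj (c : C) : exists2 s, upper s & phi s = c.
Proof. by have [[_ _ h] _ _ _] := phiP; exact: h. Qed.

Lemma iso0 : phi szero = szero.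
Proof.
have [_ phiZ _ _] := phiP; rewrite -{1}(sscale0 szero) phiZ//.
  exact: sscale0.
exact: upper_nneg.
Qed.

(** As [upper] is upward closed, suprema in [S] of its nonempty subsets lie in it, and [phi] reaches
    every candidate bound [c]. *)
Lemma iso_supremums (F : set S) s : F !=set0 -> F `<=` upper ->
  supremums F s -> supremums (phi @` F) (phi s).
Proof.
move=> [t0 Ft0] FT Fs.
have us : upper s by apply: upper_le (FT _ Ft0); exact: Fs.1.
split=> [_ [t Ft <-]|c ub]; first by rewrite iso_le//; [exact: Fs.1|exact: FT].
have [t ut te] := iso_surj c; rewrite -te iso_le//; apply: Fs.2 => v Fv.
by rewrite -iso_le//; [rewrite te; apply: ub; exists v|exact: FT].
Qed.

End Iso.

Lemma star_supremums_meetr (F : set S) s t :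
  F !=set0 -> F `<=` upper -> upper t ->
  supremums F s -> supremums [set (u `&` t)%O | u in F] (s `&` t)%O.
Proof.
move=> F0 FT ut Fs; have [C [j [phi [jC phiP]]]] := star_join_set Si.
have [_ _ _ phiI] := phiP.
have [v Fv] := F0.
have us : upper s by apply: upper_le (FT _ Fv); exact: Fs.1.
have uI u w : upper u -> upper w -> upper (u `&` w)%O.
  exact: join_setI (star_substar Si).
split=> [_ [u Fu <-]|b ub]; first by rewrite leI2// Fs.1.
have ubT : upper b.
  by apply: (@upper_le (v `&` t)%O); [apply: ub; exists v|apply: uI => //; exact: FT].
rewrite -(iso_le phiP) ?phiI//; last exact: uI.
have FC0 : phi @` F !=set0 by exists (phi v), v.
apply: (sc_supremums_meetr jC (phi t) FC0 (iso_supremums phiP F0 FT Fs)).2.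
move=> _ [_ [u Fu <-] <-]; have uu := FT u Fu.
by rewrite -phiI// (iso_le phiP)//; [apply: ub; exists u|exact: uI].
Qed.

Lemma star_gap t u : szero <= t -> szero <= u -> ~ (u <= t) ->
  exists w, [/\ szero <= w, ~ (w <= szero), w <= u &
    exists2 k : R, 0 < k < 1 &
      forall r : R, 0 <= r -> (t `&` (r *! w))%O <= k *! u].
Proof.
move=> t0 u0 ut; have [C [j [phi [jC phiP]]]] := star_join_set Si.
have [_ phiZ _ phiI] := phiP.
have uz := upper_nneg (lexx szero).
have uT := upper_nneg u0; have tT := upper_nneg t0.
have [| | |c [c0 cn cu [k k01 h]]] := sc_gap jC hE (t := phi t) (c := phi u).
- by rewrite -(iso0 phiP) (iso_le phiP).
- by rewrite -(iso0 phiP) (iso_le phiP).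
- by rewrite (iso_le phiP).
have [w wT wc] := iso_surj phiP c; rewrite -{c}wc in c0 cn cu h.
have w0 : szero <= w by rewrite -(iso_le phiP)// (iso0 phiP).
have ZT (r : R) v : 0 <= r -> szero <= v -> upper (r *! v).
  by move=> r0 v0; apply: upper_nneg; rewrite -(sscaler0_nneg r0) ler_sscale.
exists w; split=> //.
- by rewrite -(iso_le phiP)// (iso0 phiP).
- by rewrite -(iso_le phiP).
exists k => // r r0; have [k0 _] := andP k01.
rewrite -(iso_le phiP) ?phiI ?phiZ ?(ltW k0)//; try (by apply: ZT => //; exact: ltW).
  exact: h.
by apply: join_setI (star_substar Si) _ _ => //; exact: ZT.
Qed.

(** The largest element of the sup-completion gives one of [upper], and [s \/ 0] always lies in
    [upper]. Negation then gives a least element, so nonempty sets have suprema and infima in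
    [S]. *)
Lemma star_top : exists t, forall s, s <= t.
Proof.
have [C [j [phi [jC phiP]]]] := star_join_set Si.
have [c ctop] := sc_top jC; have [t tT te] := iso_surj phiP c.
exists t => s; apply: (le_trans (leUl s (i 0))).
have sT : upper (s `|` i 0)%O by exists s, 0.
by rewrite -(iso_le phiP)// te.
Qed.

Lemma star_supremum (F : set S) : F !=set0 -> exists s, supremums F s.
Proof.
move=> F0; have [t tt] := star_top.
by apply: (star_dedekind Si) => //; exists t => s _.
Qed.

Lemma star_infimum (F : set S) : F !=set0 -> exists s, infimums F s.
Proof.
move=> F0; have [t tt] := star_top.
apply: (dedekind_complete_inf (star_dedekind Si)) => //.
by exists (sopp t) => s _; rewrite -ler_sopp2 soppK.
Qed.

(* The isomorphism of [upper] with a sup-completion need not carry [i] to the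
   inclusion of [E], so that [i] preserves suprema is not immediate. If
   [x = sup X] and [u] bounds [i X] but not [i x], the gap between [u] and
   [i x] yields [y > 0] and [k < 1] with [x /\ r y <= k x] for all [r >= 0];
   then [p = sup_r (x /\ r y)] satisfies [p <= k p], so that [y <= p <= 0]. *)
Lemma emb_sup (X : set E) x u : X !=set0 -> supremums X x -> szero <= u ->
  (forall a, X a -> i a <= u) -> i x <= u.
Proof.
move=> [a0 Xa0] supX u0 Xu; apply: contrapT => xu.
have xpu : ~ (i (x `|` 0)%O <= u).
  by rewrite embU => /(le_trans (leUl _ _)).
have xp0 : 0 <= (x `|` 0)%O by exact: leUr.
have [|w [w0 wn wx [k /andP[k0 k1] h]]] := star_gap u0 _ xpu.
  by rewrite -emb0 emb_le.
have [y [y0 yw yn]] : exists y : E, [/\ 0 <= y, i y <= w & ~ (y <= 0)].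
  apply: contrapT => ne; apply: wn; apply: star_nneg_le => // y y0 yw.
  rewrite -emb0 emb_le; apply: contrapT => yn; apply: ne; exists y; split=> //.
set z := (x `|` 0)%O in xpu xp0 wx h.
have yz : y <= z by rewrite -emb_le; exact: le_trans wx.
have kz (r : R) : 0 <= r -> (z `&` (r *: y))%O <= k *: z.
  move=> r0.
  have sup1 : supremums [set (a `|` 0)%O | a in X] z.
    split=> [_ [a Xa <-]|b ub]; first by rewrite leU2// supX.1.
    rewrite leUx; apply/andP; split.
      by apply: supX.2 => a Xa; apply: le_trans (leUl a 0) _; apply: ub; exists a.
    by apply: le_trans (leUr _ a0) _; apply: ub; exists a0.
  apply: (supremums_meetr (r *: y) sup1).2 => _ [_ [a Xa <-] <-].
  rewrite -emb_le embI embU emb0 !embZ; apply: le_trans (h r r0).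
  by apply: leI2; rewrite ?leUx ?u0 ?Xu// ler_sscale.
have [||p supp] := hE (A := [set (z `&` (r *: y))%O | r in [set r | 0 <= r]]).
- by exists (z `&` (0 *: y))%O; exists 0 => //=.
- by exists z => _ [r _ <-]; exact: leIl.
have pkp : p <= k *: p.
  apply: supp.2 => _ [r r0 <-].
  apply: (@le_trans _ _ (k *: (z `&` ((k^-1 * r) *: y))%O)).
    by rewrite vl_scaleI// scalerA mulrA divff ?gt_eqF// mul1r lexI leIr kz.
  apply: vl_ler_scale; first exact: ltW.
  by apply: supp.1; exists (k^-1 * r) => //=; rewrite mulr_ge0// invr_ge0 ltW.
have yp : y <= p.
  by apply: supp.1; exists 1 => /=; rewrite ?ler01// scale1r meet_r.
apply: yn; apply: le_trans yp _.
have : (1 - k) *: p <= 0.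
  by rewrite scalerBl scale1r vl_lerBDr add0r.
by rewrite -[leRHS](scaler0 _ (1 - k)) vl_ler_pscale// subr_gt0.
Qed.

Lemma cut_below_subproof s : cut_axiom [set x | i x <= spos s].
Proof.
split.
- by exists 0; rewrite /= emb0 spos_ge0.
- by move=> x y xy /=; apply: le_trans; rewrite emb_le.
- by move=> X x X0 Xs supX; apply: emb_sup X0 supX (spos_ge0 s) Xs.
Qed.
Definition cut_below s : cut E := Cut (cut_below_subproof s).

Lemma cut_below_ge0 s : szero <= cut_below s.
Proof. by apply/cut_dn_le; rewrite /= emb0 spos_ge0. Qed.

Lemma cut_below_disjoint s : (cut_below s `&` cut_below (sopp s))%O = szero.
Proof.
apply: cut_ext => x; rewrite cut_meetE /= spos_opp -emb_le emb0.
rewrite -(spos_neg_disjoint dS vS s) lexI.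
by split=> [[-> ->]//|/andP].
Qed.

Definition to_cut_pair s : cut_pair E :=
  CutPair (cut_below_ge0 s) (cut_below_ge0 (sopp s)) (cut_below_disjoint s).

Lemma cut_below_le s t : (cut_below s <= cut_below t) = (spos s <= spos t).
Proof.
apply/idP/idP => [/cut_leP h|st]; last first.
  by apply/cut_leP => x /= xs; exact: le_trans st.
by apply: star_nneg_le => [|x _]; [exact: spos_ge0|exact: h].
Qed.

Lemma to_cut_pair_le s t : (to_cut_pair s <= to_cut_pair t) = (s <= t).
Proof. by rewrite cp_leE /= !cut_below_le !spos_opp -star_leP. Qed.

Lemma cut_belowZ (a : R) s : 0 <= a -> cut_below (a *! s) = a *! cut_below s.
Proof.
rewrite le0r => /orP[/eqP->|a0].
  rewrite !sscale0; apply: cut_ext => x /=.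
  by rewrite spos_id// -emb0 emb_le.
apply: cut_ext => x; rewrite cut_scaleE//= sposZ ?(ltW a0)// embZ.
by rewrite -(ler_psscale (_ *! i x) _ a0) sscaleVK.
Qed.

Lemma to_cut_pairZ (a : R) s : to_cut_pair (a *! s) = a *! to_cut_pair s.
Proof.
have pos b t : 0 <= b -> to_cut_pair (b *! t) = b *! to_cut_pair t.
  move=> b0; apply: cut_pair_eq; rewrite ?cp_posZ ?cp_negZ//= -cut_belowZ//.
  by rewrite /sopp !sscaleA mulrC.
have opp t : to_cut_pair (sopp t) = cp_swap (to_cut_pair t).
  by apply: cut_pair_eq; rewrite //= soppK.
have [a0|a0] := leP 0 a; first exact: pos.
have -> : a *! s = sopp ((- a) *! s) by rewrite /sopp sscaleA mulN1r opprK.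
by rewrite opp pos ?oppr_ge0 ?ltW// -cp_scaleN1 sscaleA mulN1r opprK.
Qed.

(** Take [u] to be the supremum of [i A]. Nothing new falls below it: if [z >= 0] and [i z <= u],
    distributivity makes [i z] the supremum of the [i (a /\ z)]. Since [i] reflects order, [z] is
    the supremum of the [a /\ z] in [E], and [A] is closed. *)
Lemma cut_below_surj (A : cut E) : szero <= A ->
  exists2 u, szero <= u & cut_below u = A.
Proof.
move=> /cut_dn_le A0.
have [u su] : exists u, supremums [set i a | a in cut_set A] u.
  by apply: star_supremum; exists (i 0), 0.
have u0 : szero <= u by rewrite -emb0; apply: su.1; exists 0.
exists u => //; apply: cut_ext => x; rewrite /= spos_id//; split; last first.
  by move=> Ax; apply: su.1; exists x.
move=> xu; pose z : E := (x `|` 0)%O.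
suff : A z by apply: cut_le; exact: leUl.
have zu : i z <= u by rewrite embU emb0 leUx xu u0.
have F0 : [set i a | a in cut_set A] !=set0 by exists (i 0), 0.
have := star_supremums_meetr F0 _ (upper_emb z) su.
rewrite (meet_r zu) => /(_ _)[|_ lz].
  by move=> _ [a _ <-]; exact: upper_emb.
apply: (@cut_sup _ _ A [set (a `&` z)%O | a in cut_set A]).
- by exists ((0 : E) `&` z)%O, 0.
- by move=> _ [a Aa <-]; exact: cut_le (leIl _ _) Aa.
split=> [_ [a _ <-]|b ub]; first exact: leIr.
rewrite -emb_le; apply: lz => _ [_ [a Aa <-] <-].
by rewrite -embI emb_le; apply: ub; exists a.
Qed.

(** The dual of [star_supremums_meetr] under negation, whence the condition that the negatives lie
    in [upper]. *)
Lemma infimums_join0 (F : set S) s : F !=set0 ->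
  [set sopp a | a in F] `<=` upper -> infimums F s ->
  infimums [set (a `|` szero)%O | a in F] (s `|` szero)%O.
Proof.
move=> [a0 Fa0] Fu [ls gs].
have sup1 : supremums [set sopp a | a in F] (sopp s).
  split=> [_ [a Fa <-]|b ub]; first by rewrite ler_sopp2 ls.
  rewrite -ler_sopp2 soppK; apply: gs => a Fa.
  by rewrite -ler_sopp2 soppK; apply: ub; exists a.
have [|u2 l2] := star_supremums_meetr _ Fu (upper_nneg (lexx szero)) sup1.
  by exists (sopp a0), a0.
split=> [_ [a Fa <-]|b lb]; first by rewrite leU2// ls.
rewrite -ler_sopp2 soppU sopp0; apply: l2 => _ [_ [a Fa <-] <-].
by rewrite -ler_sopp2 soppI !soppK sopp0; apply: lb; exists a.
Qed.

(* Both [sup_x inf_y (x - y)] and [inf_y sup_x (x - y)] are candidates for [s];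
   distributivity over infinite suprema is available only in [upper], which
   gives the positive part of the former and the negative part of the latter.
   As the former is below the latter, [s := inf_y sup_x (x - y)] has both. *)
Lemma star_of_disjoint u v : szero <= u -> szero <= v ->
  (u `&` v)%O = szero -> exists2 s, spos s = u & sneg s = v.
Proof.
move=> u0 v0 uv.
pose U := [set x | 0 <= x /\ i x <= u]; pose V := [set x | 0 <= x /\ i x <= v].
have U0 : U 0 by split; rewrite ?emb0.
have V0 : V 0 by split; rewrite ?emb0.
have UV x y : U x -> V y -> ((x - y) `|` 0 = x)%O /\ ((x - y) `&` 0 = - y)%O.
  move=> [x0 xu] [y0 yv]; apply: vl_disjoint; apply/le_anti.
  by rewrite lexI x0 y0 !andbT -emb_le embI emb0 -uv leI2.
have /choice[g gP] : forall y, exists t, supremums [set i (x - y) | x in U] t.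
  by move=> y; apply: star_supremum; exists (i (0 - y)), 0.
have /choice[f fP] : forall x, exists t, infimums [set i (x - y) | y in V] t.
  by move=> x; apply: star_infimum; exists (i (x - 0)), 0.
have [s [ls gs]] : exists s, infimums [set g y | y in V] s.
  by apply: star_infimum; exists (g 0), 0.
have fs x : U x -> f x <= s.
  move=> Ux; apply: gs => _ [y Vy <-]; apply: (@le_trans _ _ (i (x - y))).
    by apply: (fP x).1; exists y.
  by apply: (gP y).1; exists x.
have fpos x : U x -> (f x `|` szero)%O = i x.
  move=> Ux; have [||lf gf] := infimums_join0 _ _ (fP x).
  - by exists (i (x - 0)), 0.
  - by move=> _ [_ [y _ <-] <-]; rewrite -embN; exact: upper_emb.
  apply/le_anti/andP; split.
    by apply: lf; exists (i (x - 0)); [exists 0|rewrite -emb0 -embU (UV _ _ Ux V0).1].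
  by apply: gf => _ [_ [y Vy <-] <-]; rewrite -emb0 -embU (UV _ _ Ux Vy).1.
have gneg y : V y -> (g y `&` szero)%O = i (- y).
  move=> Vy; have [||ug lg] :=
    star_supremums_meetr _ _ (upper_nneg (lexx szero)) (gP y).
  - by exists (i (0 - y)), 0.
  - by move=> _ [x _ <-]; exact: upper_emb.
  apply/le_anti/andP; split.
    by apply: lg => _ [_ [x Ux <-] <-]; rewrite -emb0 -embI (UV _ _ Ux Vy).2.
  by apply: ug; exists (i (0 - y)); [exists 0|rewrite -emb0 -embI (UV _ _ U0 Vy).2].
exists s; apply/le_anti/andP; split.
- rewrite leUx u0 andbT; apply: (@le_trans _ _ (g 0)); first by apply: ls; exists 0.
  by apply: (gP 0).2 => _ [x [_ xu] <-]; rewrite subr0.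
- apply: star_nneg_le => // x x0 xu.
  by rewrite -(fpos x)//; apply: leU2 => //; exact: fs.
- rewrite -ler_sopp2 soppK lexI; apply/andP; split; last first.
    by rewrite -ler_sopp2 soppK sopp0.
  apply: gs => _ [y Vy <-]; apply: (@le_trans _ _ (i (- y))).
    by rewrite embN ler_sopp2; case: Vy.
  by rewrite -gneg// leIl.
- apply: star_nneg_le => // y y0 yv; rewrite -ler_sopp2 soppK -embN.
  by rewrite -gneg//; apply: leI2 => //; apply: ls; exists y.
Qed.

Lemma to_cut_pair_surj (p : cut_pair E) : exists s, to_cut_pair s = p.
Proof.
have [u u0 up] := cut_below_surj (cp_pos_ge0 p).
have [v v0 vp] := cut_below_surj (cp_neg_ge0 p).
have [|s su sv] := star_of_disjoint u0 v0.
  (* Disjointness of [u] and [v] is tested on elements of [E], where it is that of the two cuts. *)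
  apply/le_anti; rewrite lexI u0 v0 !andbT.
  apply: star_nneg_le => [|x x0]; first by rewrite lexI u0.
  rewrite lexI -emb0 emb_le => /andP[xu xv].
  have : (cp_pos p `&` cp_neg p)%O x.
    by rewrite -up -vp; split; rewrite /= spos_id.
  by rewrite cp_disjoint.
exists s; apply: cut_pair_eq; apply: cut_ext => x /=.
  by rewrite su -up /= spos_id.
by rewrite spos_opp sv -vp /= spos_id.
Qed.

Lemma star_iso_cut_pair : lattice_star_isomorphic S (cut_pair E).
Proof.
have /choice[h hK] := to_cut_pair_surj.
have inj : injective to_cut_pair.
  by move=> s t st; apply/le_anti; rewrite -!to_cut_pair_le st lexx.
have Kh : cancel to_cut_pair h by move=> s; apply: inj; rewrite hK.
exists to_cut_pair; split; first by exists h.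
split; first exact: to_cut_pairZ.
(* A surjective order embedding preserves joins: pulling the join of the images back along [h] gives
   an upper bound of [s] and [t]. *)
move=> s t; apply/le_anti/andP; split; last by rewrite leUx !to_cut_pair_le leUl leUr.
by rewrite -[leRHS]hK to_cut_pair_le leUx -!to_cut_pair_le hK leUl leUr.
Qed.

End Completion.

(** * Comparison of two completions through the model *)

Lemma lattice_star_isomorphic_sym (R : realType) (S1 S2 : latticeStarType R) :
  lattice_star_isomorphic S1 S2 -> lattice_star_isomorphic S2 S1.
Proof.
move=> [phi [[psi phiK psiK] [phiZ phiU]]]; exists psi; split; first by exists phi.
by split=> [a x|x y]; apply: (can_inj phiK); rewrite ?phiZ ?phiU !psiK.
Qed.

Lemma lattice_star_isomorphic_trans (R : realType) (S1 S2 S3 : latticeStarType R) :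
  lattice_star_isomorphic S1 S2 -> lattice_star_isomorphic S2 S3 ->
  lattice_star_isomorphic S1 S3.
Proof.
move=> [phi [phi_bij [phiZ phiU]]] [psi [psi_bij [psiZ psiU]]].
exists (psi \o phi); split; first exact: bij_comp.
by split=> [a x|x y] /=; rewrite ?phiZ ?phiU.
Qed.

Theorem theorem4p1 (R : realType) (E : vectorLatticeType R)
    (hE : dedekind_complete E) :
  (exists (S : latticeStarType R) (i : E -> S), is_star_completion i) /\
  (forall (S1 S2 : latticeStarType R) (i1 : E -> S1) (i2 : E -> S2),
     is_star_completion i1 -> is_star_completion i2 ->
     lattice_star_isomorphic S1 S2).
Proof.
split; first by exists (cut_pair E), (@cp_emb R E); exact: cp_is_star_completion.
move=> S1 S2 i1 i2 S1i S2i.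
apply: lattice_star_isomorphic_trans (star_iso_cut_pair hE S1i) _.
exact/lattice_star_isomorphic_sym/(star_iso_cut_pair hE S2i).
Qed.
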